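(* Let $\mathcal{D}$ be a nontrivial balanced quadriculated disk. For $N\in\mathbb{N}$ let $\mathbf{T}_1$ and $\mathbf{T}_2$ be two independent (uniformly) random domino tilings of $\mathcal{D}\times[0,N]$. If $\mathcal{D}$ is strongly irregular, then there exists $c\in(0,1)$ such that $\mathbb{P}(\mathbf{T}_1\approx\mathbf{T}_2)=o(c^N)$ as $N\to\infty$.
   Context: A quadriculated disk $\mathcal{D}\subset\mathbb{R}^2$ is a finite union of closed unit squares with vertices in $\mathbb{Z}^2$ that is homeomorphic to a closed disk. The unit square $[a,a+1]\times[b,b+1]$, $(a,b)\in\mathbb{Z}^2$, is white if $a+b$ is even and black if $a+b$ is odd. Two unit squares are adjacent if they share an edge. $\mathcal{D}$ is balanced if it contains equally many white and black unit squares; it is trivial if each of its unit squares is adjacent to at most two other unit squares of $\mathcal{D}$, and nontrivial otherwise. A (3D) domino is a union of two unit cubes (with vertices in $\mathbb{Z}^3$) sharing a face; a tiling of a cubiculated region is a covering of it by dominoes contained in it with pairwise disjoint interiors. A flip removes two parallel dominoes of a tiling whose union is a $2\times2\times1$ slab (in any orientation) and puts them back in the other possible position. For tilings $\mathbf{t}_1,\mathbf{t}_2$ of $\mathcal{D}\times[0,N]$, $\mathbf{t}_1\approx\mathbf{t}_2$ means they can be joined by a finite sequence of flips. Domino group. A plug is a union $p\subseteq\mathcal{D}$ of unit squares of $\mathcal{D}$ with equally many white and black squares; $\mathbf{p}_\circ=\emptyset$ is the empty plug. Two plugs are disjoint if their interiors are disjoint. A planar domino is a union of two adjacent unit squares.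 The 2-complex $\mathcal{C}_{\mathcal{D}}$ is defined as follows. - Vertices: the plugs. - Edges: for every two distinct disjoint plugs $p_1,p_2$, one edge between $p_1$ and $p_2$ for each planar domino tiling of $\mathcal{D}\smallsetminus\mathrm{int}(p_1\cup p_2)$ (the empty region has exactly one tiling, the empty one); also one loop at $\mathbf{p}_\circ$ for each planar domino tiling of $\mathcal{D}$. - 2-cells: (i) for each loop $f$, a disk attached along $f*f$ (so that a projective plane results); (ii) for each two edges joining the same two distinct plugs whose tilings differ by a single planar flip (replacing two parallel dominoes forming a $2\times2$ square by the other two), a disk attached along the resulting bigon; (iii) for each four plugs $p_1,p_2,p_3,p_4$ with $p_2$ disjoint from $p_1$ and from $p_4$, and $p_2=p_3\cup d$ where $d$ is a domino whose two unit squares are not in $p_3$, and for each tiling $f_1^*$ of $\mathcal{D}\smallsetminus\mathrm{int}(p_1\cup p_2)$ and each tiling $f_2^*$ of $\mathcal{D}\smallsetminus\mathrm{int}(p_2\cup p_4)$, a disk attached along the quadrilateral $p_1\to p_2\to p_4\to p_3\to p_1$ with edges $f_1^*$, $f_2^*$, $f_2^*\cup\{d\}$, $f_1^*\cup\{d\}$. The domino group is $G_{\mathcal{D}}=\pi_1(\mathcal{C}_{\mathcal{D}},\mathbf{p}_\circ)$. The even domino group $G_{\mathcal{D}}^+$ is the kernel of the homomorphism $G_{\mathcal{D}}\to\mathbb{Z}/(2)$ sending a closed edge path of length $N$ to $N \bmod 2$. The disk $\mathcal{D}$ is strongly irregular if there exists a surjective homomorphism from $G_{\mathcal{D}}^+$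 onto the free group $F_2$ of rank two. *)

(* Defs.v *)
From HB Require Import structures.
From mathcomp Require Import all_boot all_order all_algebra.
From mathcomp Require Import generic_quotient finmap boolp.
From Stdlib Require Import Relation_Operators.

Set Implicit Arguments.
Unset Strict Implicit.
Unset Printing Implicit Defensive.

Import Order.TTheory GRing.Theory Num.Theory.

Local Open Scope quotient_scope.

(* [insertion R s s'] inserts into the word s one word of R. *)
Definition insertion A (R : seq A -> Prop) (s s' : seq A) : Prop :=
  exists s1 c s2, [/\ R c, s = s1 ++ s2 & s' = s1 ++ c ++ s2].

Section FreeGroup.
Variable X : choiceType.

(* (x, false) is the generator x and (x, true) its formal inverse. *)
Notation letter := (X * bool)%type.

Definition letter_inv (l : letter) : letter := (l.1, ~~ l.2).

Definition cancelling_pair (c : seq letter) : Prop :=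
  exists l, c = [:: l; letter_inv l].

Definition free_equiv : seq letter -> seq letter -> Prop :=
  clos_refl_sym_trans _ (insertion cancelling_pair).

Definition free_rel : rel (seq letter) := fun s t => `[< free_equiv s t >].

Lemma free_rel_refl : reflexive free_rel.
Proof. by move=> s; apply/asboolP; apply: rst_refl. Qed.

Lemma free_rel_sym : symmetric free_rel.
Proof. by move=> s t; apply/asboolP/asboolP; apply: rst_sym. Qed.

Lemma free_rel_trans : transitive free_rel.
Proof.
by move=> t s u /asboolP st /asboolP tu; apply/asboolP/(rst_trans _ _ _ t).
Qed.

Canonical free_equiv_rel :=
  EquivRel free_rel free_rel_refl free_rel_sym free_rel_trans.

Definition free_group := {eq_quot free_equiv_rel}.

HB.instance Definition _ := Choice.on free_group.
HB.instance Definition _ := EqQuotient.on free_group.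

Lemma free_equivP s t :
  reflect (free_equiv s t) (\pi_free_group s == \pi_free_group t).
Proof. by rewrite eqmodE; apply: asboolP. Qed.

Lemma free_equiv_cat s t u : free_equiv s t -> free_equiv (s ++ u) (t ++ u).
Proof.
elim=> [a b [s1 [c [s2 [Rc -> ->]]]]|a|a b _|a b c _ + _];
  last exact: rst_trans.
- by apply: rst_step; exists s1, c, (s2 ++ u); rewrite -!catA.
- exact: rst_refl.
- exact: rst_sym.
Qed.

Lemma free_equiv_catl s t u : free_equiv s t -> free_equiv (u ++ s) (u ++ t).
Proof.
elim=> [a b [s1 [c [s2 [Rc -> ->]]]]|a|a b _|a b c _ + _];
  last exact: rst_trans.
- by apply: rst_step; exists (u ++ s1), c, s2; rewrite -!catA.
- exact: rst_refl.
- exact: rst_sym.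
Qed.

Definition word_inv (s : seq letter) := rev (map letter_inv s).

Lemma letter_invK : involutive letter_inv.
Proof. by case=> x b; rewrite /letter_inv /= negbK. Qed.

Lemma free_equiv_inv s t :
  free_equiv s t -> free_equiv (word_inv s) (word_inv t).
Proof.
elim=> [a b [s1 [_ [s2 [[l ->] -> ->]]]]|a|a b _|a b c _ + _];
  last exact: rst_trans.
- apply: rst_step; exists (word_inv s2), [:: l; letter_inv l], (word_inv s1).
  split; [by exists l | by rewrite /word_inv map_cat rev_cat |].
  by rewrite /word_inv !map_cat !rev_cat -catA /= letter_invK.
- exact: rst_refl.
- exact: rst_sym.
Qed.

Lemma free_equivV s : free_equiv (s ++ word_inv s) [::].
Proof.
elim: s => [|l s IHs]; first exact: rst_refl.
have -> : (l :: s) ++ word_inv (l :: s) =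
    [:: l] ++ (s ++ word_inv s) ++ [:: letter_inv l].
  by rewrite /word_inv map_cons rev_cons -cats1 -catA.
apply: (rst_trans _ _ _ ([:: l] ++ [:: letter_inv l])).
  exact/free_equiv_catl/(free_equiv_cat _ IHs).
by apply/rst_sym/rst_step; exists [::], [:: l; letter_inv l], [::];
  split=> //; exists l.
Qed.

Lemma word_invK : involutive word_inv.
Proof. by move=> s; rewrite /word_inv map_rev revK (mapK letter_invK). Qed.

Definition free_one : free_group := \pi_free_group [::].
Definition free_mul (g h : free_group) : free_group :=
  \pi_free_group (repr g ++ repr h).
Definition free_inv (g : free_group) : free_group :=
  \pi_free_group (word_inv (repr g)).

Lemma repr_free s : free_equiv (repr (\pi_free_group s)) s.
Proof. by apply/free_equivP; rewrite reprK. Qed.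

Lemma free_piP (g : free_group) : exists s, g = \pi_free_group s.
Proof. by exists (repr g); rewrite reprK. Qed.

Lemma free_mulE s t :
  free_mul (\pi_free_group s) (\pi_free_group t) = \pi_free_group (s ++ t).
Proof.
apply/eqP/free_equivP; apply: (rst_trans _ _ _ (s ++ repr (\pi_free_group t))).
  exact: free_equiv_cat (repr_free s).
exact: free_equiv_catl (repr_free t).
Qed.

Lemma free_invE s : free_inv (\pi_free_group s) = \pi_free_group (word_inv s).
Proof. by apply/eqP/free_equivP; exact: free_equiv_inv (repr_free s). Qed.

Lemma free_mulA : associative free_mul.
Proof.
move=> g h k; have [s ->] := free_piP g; have [t ->] := free_piP h.
by have [u ->] := free_piP k; rewrite !free_mulE catA.
Qed.

Lemma free_mul1g : left_id free_one free_mul.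
Proof. by move=> g; have [s ->] := free_piP g; rewrite free_mulE. Qed.

Lemma free_mulg1 : right_id free_one free_mul.
Proof. by move=> g; have [s ->] := free_piP g; rewrite free_mulE cats0. Qed.

Lemma free_mulgV : right_inverse free_one free_inv free_mul.
Proof.
move=> g; have [s ->] := free_piP g; rewrite free_invE free_mulE.
by apply/eqP/free_equivP; apply: free_equivV.
Qed.

Lemma free_mulVg : left_inverse free_one free_inv free_mul.
Proof.
move=> g; have [s ->] := free_piP g; rewrite free_invE free_mulE.
apply/eqP/free_equivP.
by rewrite -[X in _ ++ X]word_invK; apply: free_equivV.
Qed.

HB.instance Definition _ := isGroup.Build free_group
  free_mulA free_mul1g free_mulg1 free_mulVg free_mulgV.

End FreeGroup.

Notation F2 := (free_group bool).

(* Graphs in the sense of Serre: each edge is a pair {d, drev d} of opposite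
   darts, so a loop also has two darts. *)
Record graph := Graph {
  vertex : eqType;
  dart : choiceType;
  dsrc : dart -> vertex;
  dtgt : dart -> vertex;
  drev : dart -> dart;
  drevK : involutive drev;
  drev_neq : forall d, drev d != d;
  dsrc_rev : forall d, dsrc (drev d) = dtgt d
}.

Section Walk.
Variable K : graph.

Fixpoint walk (x : vertex K) (s : seq (dart K)) (y : vertex K) : bool :=
  if s is d :: s' then (dsrc d == x) && walk (dtgt d) s' y else x == y.

Lemma walk_cat x s z t y : walk x s z -> walk z t y -> walk x (s ++ t) y.
Proof. by elim: s x => [|d s IHs] x /=; [move/eqP-> | case/andP=> -> /IHs]. Qed.

Lemma walk_split x s t y :
  walk x (s ++ t) y -> exists2 z, walk x s z & walk z t y.
Proof.
elim: s x => [|d s IHs] x /=; first by exists x.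
by case/andP=> -> /IHs[z]; exists z.
Qed.

Lemma walk_end x s y z : walk x s y -> walk x s z -> y = z.
Proof.
elim: s x => [|d s IHs] x /=; first by move=> /eqP-> /eqP.
by case/andP=> _ sy /andP[_ sz]; apply: IHs sy sz.
Qed.

Lemma walk_start x x' s y : walk x s y -> walk x' s y -> x = x'.
Proof.
by case: s => [/eqP-> /eqP->//|d s /= /andP[/eqP<- _] /andP[/eqP<- _]].
Qed.

Definition walk_inv (s : seq (dart K)) := rev (map (@drev K) s).

Lemma dtgt_rev (d : dart K) : dtgt (drev d) = dsrc d.
Proof. by rewrite -dsrc_rev drevK. Qed.

Lemma walkV x s y : walk x s y -> walk y (walk_inv s) x.
Proof.
elim: s x => [|d s IHs] x /=; first by rewrite eq_sym.
case/andP=> /eqP<- /IHs ws; rewrite /walk_inv map_cons rev_cons -cats1.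
by apply: walk_cat ws _; rewrite /= dsrc_rev dtgt_rev !eqxx.
Qed.

Lemma walk_invK : involutive walk_inv.
Proof. by move=> s; rewrite /walk_inv map_rev revK (mapK (@drevK K)). Qed.

Lemma walk_inv_cat s t : walk_inv (s ++ t) = walk_inv t ++ walk_inv s.
Proof. by rewrite /walk_inv map_cat rev_cat. Qed.

End Walk.

(* [face c] says that a 2-cell is attached along the closed walk c. *)
Record two_complex := TwoComplex {
  skeleton :> graph;
  face : seq (dart skeleton) -> Prop;
  face_closed : forall c, face c -> exists x, walk x c x
}.

Section FundamentalGroup.
Variables (K : two_complex) (x0 : vertex K).

Definition null_walk (c : seq (dart K)) : Prop :=
  face c \/ exists d, c = [:: d; drev d].

(* Both ends of each elementary homotopy are closed walks at x0. *)
Definition homotopic : seq (dart K) -> seq (dart K) -> Prop :=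
  clos_refl_sym_trans _
    (fun s t => [/\ walk x0 s x0, walk x0 t x0 & insertion null_walk s t]).

Definition closed_walk := {s : seq (dart K) | walk x0 s x0}.

Definition homotopy_rel : rel closed_walk :=
  fun s t => `[< homotopic (val s) (val t) >].

Lemma homotopy_rel_refl : reflexive homotopy_rel.
Proof. by move=> s; apply/asboolP; apply: rst_refl. Qed.

Lemma homotopy_rel_sym : symmetric homotopy_rel.
Proof. by move=> s t; apply/asboolP/asboolP; apply: rst_sym. Qed.

Lemma homotopy_rel_trans : transitive homotopy_rel.
Proof.
move=> t s u /asboolP st /asboolP tu; apply/asboolP.
exact: rst_trans st tu.
Qed.

Canonical homotopy_equiv_rel :=
  EquivRel homotopy_rel homotopy_rel_refl homotopy_rel_sym homotopy_rel_trans.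

(* The edge-path group of K at x0. *)
Definition pi1 := {eq_quot homotopy_equiv_rel}.

HB.instance Definition _ := Choice.on pi1.
HB.instance Definition _ := EqQuotient.on pi1.

Lemma homotopicP (s t : closed_walk) :
  reflect (homotopic (val s) (val t)) (\pi_pi1 s == \pi_pi1 t).
Proof. by rewrite eqmodE; apply: asboolP. Qed.

Lemma homotopic_catr s t u :
  walk x0 u x0 -> homotopic s t -> homotopic (s ++ u) (t ++ u).
Proof.
move=> wu; elim=> [a b [wa wb [s1 [c [s2 [Rc ea eb]]]]]|a|a b _|a b c _ + _];
  last exact: rst_trans.
- apply: rst_step; split; [exact: walk_cat wa wu | exact: walk_cat wb wu |].
  by exists s1, c, (s2 ++ u); rewrite ea eb -!catA.
- exact: rst_refl.
- exact: rst_sym.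
Qed.

Lemma homotopic_catl s t u :
  walk x0 u x0 -> homotopic s t -> homotopic (u ++ s) (u ++ t).
Proof.
move=> wu; elim=> [a b [wa wb [s1 [c [s2 [Rc ea eb]]]]]|a|a b _|a b c _ + _];
  last exact: rst_trans.
- apply: rst_step; split; [exact: walk_cat wu wa | exact: walk_cat wu wb |].
  by exists (u ++ s1), c, s2; rewrite ea eb -!catA.
- exact: rst_refl.
- exact: rst_sym.
Qed.

Lemma homotopic_cancel s1 c s2 x y :
  walk x0 s1 x -> walk x c y -> walk x s2 x0 ->
  homotopic (s1 ++ s2) (s1 ++ c ++ walk_inv c ++ s2).
Proof.
elim: c x s1 s2 => [|d c IHc] x s1 s2 ws1; first by move=> *; apply: rst_refl.
move=> /= /andP[/eqP srcd wc] ws2; rewrite /walk_inv map_cons rev_cons -cats1.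
have wd : walk x [:: d] (dtgt d) by rewrite /= srcd !eqxx.
have wdr : walk (dtgt d) [:: drev d] x.
  by rewrite /= dsrc_rev dtgt_rev srcd !eqxx.
apply: (rst_trans _ _ _ (s1 ++ [:: d; drev d] ++ s2)).
  apply: rst_step; split; first exact: walk_cat ws1 ws2.
    by apply: walk_cat ws1 _; apply: walk_cat (walk_cat wd wdr) ws2.
  by exists s1, [:: d; drev d], s2; split=> //; right; exists d.
have := IHc (dtgt d) (s1 ++ [:: d]) ([:: drev d] ++ s2)
  (walk_cat ws1 wd) wc (walk_cat wdr ws2).
by rewrite -!catA.
Qed.

Lemma homotopicV s t : homotopic s t -> homotopic (walk_inv s) (walk_inv t).
Proof.
elim=> [a b [wa wb [s1 [c [s2 [Rc ea eb]]]]]|a|a b _|a b c _ + _];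
  [|exact: rst_refl|exact: rst_sym|exact: rst_trans].
subst a b; rewrite !walk_inv_cat.
have [x ws1 ws2] := walk_split wa; have [x' ws1' wc2] := walk_split wb.
have [y wc ws2'] := walk_split wc2.
move: (walk_end ws1 ws1') (walk_start ws2 ws2') wc => <- <- wc.
move=> {x' y ws1' ws2' wc2}.
have [[wV1 wV2] wVc] := (walkV ws1, walkV ws2, walkV wc).
rewrite -catA.
apply: (rst_trans _ _ _
  (walk_inv s2 ++ walk_inv c ++ walk_inv (walk_inv c) ++ walk_inv s1)).
  exact: homotopic_cancel wV2 wVc wV1.
rewrite walk_invK; apply/rst_sym/rst_step; split.
- exact: walk_cat wV2 (walk_cat wVc wV1).
- exact: walk_cat wV2 (walk_cat wVc (walk_cat wc wV1)).
- by exists (walk_inv s2 ++ walk_inv c), c, (walk_inv s1); rewrite -!catA.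
Qed.

Lemma homotopicVr s : walk x0 s x0 -> homotopic (s ++ walk_inv s) [::].
Proof.
move=> ws; apply: rst_sym.
rewrite -[walk_inv s]cats0.
exact: (@homotopic_cancel [::] s [::] x0 x0 (eqxx _) ws (eqxx _)).
Qed.

Definition closed_nil : closed_walk := exist _ [::] (eqxx x0).
Definition closed_cat (s t : closed_walk) : closed_walk :=
  exist _ (val s ++ val t) (walk_cat (valP s) (valP t)).
Definition closed_inv (s : closed_walk) : closed_walk :=
  exist _ (walk_inv (val s)) (walkV (valP s)).

Definition pi1_one : pi1 := \pi_pi1 closed_nil.
Definition pi1_mul (g h : pi1) : pi1 := \pi_pi1 (closed_cat (repr g) (repr h)).
Definition pi1_inv (g : pi1) : pi1 := \pi_pi1 (closed_inv (repr g)).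

Lemma repr_pi1 s : homotopic (val (repr (\pi_pi1 s))) (val s).
Proof. by apply/homotopicP; rewrite reprK. Qed.

Lemma pi1_piP (g : pi1) : exists s, g = \pi_pi1 s.
Proof. by exists (repr g); rewrite reprK. Qed.

Lemma pi1_mulE s t : pi1_mul (\pi_pi1 s) (\pi_pi1 t) = \pi_pi1 (closed_cat s t).
Proof.
apply/eqP/homotopicP.
apply: (rst_trans _ _ _ (val s ++ val (repr (\pi_pi1 t)))).
  exact: homotopic_catr (valP (repr (\pi_pi1 t))) (repr_pi1 s).
exact: homotopic_catl (valP s) (repr_pi1 t).
Qed.

Lemma pi1_invE s : pi1_inv (\pi_pi1 s) = \pi_pi1 (closed_inv s).
Proof. by apply/eqP/homotopicP; exact: homotopicV (repr_pi1 s). Qed.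

Lemma pi1_mulA : associative pi1_mul.
Proof.
move=> g h k; have [s ->] := pi1_piP g; have [t ->] := pi1_piP h.
have [u ->] := pi1_piP k; rewrite !pi1_mulE.
by congr (\pi _); apply: val_inj; rewrite /= catA.
Qed.

Lemma pi1_mul1g : left_id pi1_one pi1_mul.
Proof.
move=> g; have [s ->] := pi1_piP g; rewrite pi1_mulE.
by congr (\pi _); apply: val_inj.
Qed.

Lemma pi1_mulg1 : right_id pi1_one pi1_mul.
Proof.
move=> g; have [s ->] := pi1_piP g; rewrite pi1_mulE.
congr (\pi _); apply: val_inj; by rewrite /= cats0.
Qed.

Lemma pi1_mulgV : right_inverse pi1_one pi1_inv pi1_mul.
Proof.
move=> g; have [s ->] := pi1_piP g; rewrite pi1_invE pi1_mulE.
apply/eqP/homotopicP.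
exact: homotopicVr (valP s).
Qed.

Lemma pi1_mulVg : left_inverse pi1_one pi1_inv pi1_mul.
Proof.
move=> g; have [s ->] := pi1_piP g; rewrite pi1_invE pi1_mulE.
apply/eqP/homotopicP.
by rewrite /= -[X in _ ++ X]walk_invK; exact: homotopicVr (walkV (valP s)).
Qed.

HB.instance Definition _ := isGroup.Build pi1
  pi1_mulA pi1_mul1g pi1_mulg1 pi1_mulVg pi1_mulgV.

End FundamentalGroup.

Local Open Scope ring_scope.

(* Unit cells of a lattice V are located by their lowest vertex, and dirs lists
   the unit coordinate vectors. *)
Section Dominoes.
Variables (V : zmodType) (dirs : seq V) (T : finType) (pos : T -> V).

Definition adjacent (x y : T) : bool :=
  has (fun u => (pos y == pos x + u) || (pos x == pos y + u)) dirs.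

Definition is_domino (d : {set T}) : bool :=
  [exists x, exists y, adjacent x y && (d == [set x; y])].

Definition is_tiling (A : {set T}) (t : {set {set T}}) : bool :=
  partition t A && [forall d in t, is_domino d].

(* The dominoes ab, cd of the 2 x 2 slab
     c d
     a b   are replaced by ac, bd. *)
Definition flip (t t' : {set {set T}}) : bool :=
  [exists a, exists b, exists c, exists d,
    [&& has (fun u => has (fun v =>
          [&& u != v, pos b == pos a + u, pos c == pos a + v
            & pos d == pos a + u + v]) dirs) dirs,
        [set a; b] \in t, [set c; d] \in t
      & t' == [set a; c] |: ([set b; d] |: (t :\ [set a; b] :\ [set c; d]))]].

End Dominoes.

Definition dirs2 : seq (int * int) := [:: (1, 0); (0, 1)].
Definition dirs3 : seq (int * int * int) :=
  [:: (1, 0, 0); (0, 1, 0); (0, 0, 1)].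

Section Disk.
(* (a, b) in D stands for the unit square [a, a+1] x [b, b+1]. *)
Variable D : {fset int * int}.

Definition white (x : D) : bool := (2 %| (val x).1 + (val x).2)%Z.

Definition balanced_set (p : {set D}) : bool :=
  #|[set x in p | white x]| == #|[set x in p | ~~ white x]|.

Definition balanced : bool := balanced_set [set: D].

Definition sq_pos (x : D) : int * int := val x.

Definition sq_adjacent : rel D := adjacent dirs2 sq_pos.

Definition trivial_disk : bool :=
  [forall x : D, #|[set y | sq_adjacent x y]| <= 2]%N.

Definition nontrivial_disk : bool := ~~ trivial_disk.

Definition planar_domino (d : {set D}) : bool := is_domino dirs2 sq_pos d.
Definition planar_tiling (A : {set D}) (t : {set {set D}}) : bool :=
  is_tiling dirs2 sq_pos A t.
Definition planar_flip (t t' : {set {set D}}) : bool := flip dirs2 sq_pos t t'.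

Section Cylinder.
Variable N : nat.

(* (x, k) is the unit cube over the square x at height [k, k+1]. *)
Definition cube : finType := (D * 'I_N)%type.

Definition cube_pos (q : cube) : int * int * int := (val q.1, (q.2 : nat)%:Z).

Definition cylinder_tiling :=
  {t : {set {set cube}} | is_tiling dirs3 cube_pos [set: cube] t}.

HB.instance Definition _ := Finite.on cylinder_tiling.

Definition cylinder_flip (t t' : cylinder_tiling) : bool :=
  flip dirs3 cube_pos (val t) (val t').

Definition flip_equiv (t t' : cylinder_tiling) : bool :=
  connect cylinder_flip t t'.

End Cylinder.

Definition plug := {p : {set D} | balanced_set p}.

HB.instance Definition _ := Finite.on plug.

Fact empty_plug_subproof : balanced_set set0.
Proof.
by apply/eqP; congr #|pred_of_set _|; apply/setP=> x; rewrite !inE.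
Qed.

Definition empty_plug : plug := exist _ set0 empty_plug_subproof.

(* An edge between distinct plugs, oriented: (p, q, t) and (q, p, t) are the two
   darts of one edge. *)
Definition link := {e : plug * plug * {set {set D}} |
  [&& e.1.1 != e.1.2, [disjoint val e.1.1 & val e.1.2]
    & planar_tiling (~: (val e.1.1 :|: val e.1.2)) e.2]}.

HB.instance Definition _ := Finite.on link.

Definition loop := {t : {set {set D}} | planar_tiling [set: D] t}.

HB.instance Definition _ := Finite.on loop.

(* (f, true) and (f, false) are the two orientations of the loop f. *)
Definition floor : choiceType := (link + loop * bool)%type.

Definition floor_src (a : floor) : plug :=
  match a with inl e => (val e).1.1 | inr _ => empty_plug end.

Definition floor_tgt (a : floor) : plug :=
  match a with inl e => (val e).1.2 | inr _ => empty_plug end.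

Definition floor_tiling (a : floor) : {set {set D}} :=
  match a with inl e => (val e).2 | inr f => val f.1 end.

Definition floor_positive (a : floor) : bool :=
  match a with inl _ => true | inr f => f.2 end.

Fact link_rev_subproof (e : link) :
  [&& (val e).1.2 != (val e).1.1, [disjoint val (val e).1.2 & val (val e).1.1]
    & planar_tiling (~: (val (val e).1.2 :|: val (val e).1.1)) (val e).2].
Proof. by rewrite eq_sym disjoint_sym setUC; apply: (valP e). Qed.

Definition link_rev (e : link) : link :=
  exist _ ((val e).1.2, (val e).1.1, (val e).2) (link_rev_subproof e).

Definition floor_rev (a : floor) : floor :=
  match a with inl e => inl (link_rev e) | inr f => inr (f.1, ~~ f.2) end.

Fact floor_revK : involutive floor_rev.
Proof.
case=> [e|[f b]] /=; last by rewrite negbK.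
by congr inl; apply: val_inj; case: e => [[[p q] t] ?].
Qed.

Fact floor_rev_neq a : floor_rev a != a.
Proof.
case: a => [e|[f b]]; apply/eqP; last by case; case: b.
case=> /(congr1 (fun e : link => (val e).1.1)) /= eqp.
by have /and3P[/eqP] := valP e; rewrite eqp.
Qed.

Fact floor_src_rev a : floor_src (floor_rev a) = floor_tgt a.
Proof. by case: a. Qed.

Definition domino_graph : graph := Graph floor_revK floor_rev_neq floor_src_rev.

(* a is the edge from p to q with tiling t; a loop is traversed in its positive
   direction. *)
Definition floor_spec (p q : plug) (t : {set {set D}})
    (a : dart domino_graph) : bool :=
  [&& floor_src a == p, floor_tgt a == q, floor_tiling a == t
    & floor_positive a].

Inductive domino_face : seq (dart domino_graph) -> Prop :=
| LoopFace f a of floor_spec empty_plug empty_plug f a :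
    domino_face [:: a; a]
| BigonFace (p q : plug) t1 t2 a b of
    p != q & planar_flip t1 t2 &
    floor_spec p q t1 a & floor_spec q p t2 b :
    domino_face [:: a; b]
| SquareFace (p1 p2 p3 p4 : plug) d f1 f2 a b a' b' of
    [disjoint val p2 & val p1] & [disjoint val p2 & val p4] &
    planar_domino d & [disjoint d & val p3] & val p2 = val p3 :|: d &
    floor_spec p1 p2 f1 a & floor_spec p2 p4 f2 b &
    floor_spec p4 p3 (d |: f2) b' & floor_spec p3 p1 (d |: f1) a' :
    domino_face [:: a; b; b'; a'].

Fact domino_face_closed c : domino_face c -> exists x, walk x c x.
Proof.
case=> [f a|p q t1 t2 a b _ _|p1 p2 p3 p4 d f1 f2 a b a' b' _ _ _ _ _].
- case/and4P=> /eqP ps /eqP pt _ _.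
  by exists empty_plug; rewrite /= ps pt !eqxx.
- move=> /and4P[/eqP sa /eqP ta _ _] /and4P[/eqP sb /eqP tb _ _].
  by exists p; rewrite /= sa ta sb tb !eqxx.
- move=> /and4P[/eqP sa /eqP ta _ _] /and4P[/eqP sb /eqP tb _ _].
  move=> /and4P[/eqP sb' /eqP tb' _ _] /and4P[/eqP sa' /eqP ta' _ _].
  by exists p1; rewrite /= sa ta sb tb sb' tb' sa' ta' !eqxx.
Qed.

Definition domino_complex : two_complex := TwoComplex domino_face_closed.

Definition domino_group : groupType := @pi1 domino_complex empty_plug.

Definition length_mod2 (g : domino_group) : 'Z_2 := (size (val (repr g)))%:R.

Lemma size_mod2 n : (n%:R == 0 :> 'Z_2) = ~~ odd n.
Proof. by rewrite -val_eqE /= Zp_nat /= modn2; case: odd. Qed.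

Lemma homotopic_size s t :
  @homotopic domino_complex empty_plug s t -> (size s)%:R = (size t)%:R :> 'Z_2.
Proof.
elim=> [a b [_ _ [s1 [c [s2 [Rc -> ->]]]]]|//|a b _ ->//|a b c _ -> _ ->//].
have /eqP c0 : (size c)%:R == 0 :> 'Z_2.
  by rewrite size_mod2; case: Rc => [[]|[d ->]].
by rewrite !size_cat !natrD c0 add0r.
Qed.

Lemma length_mod2E s : length_mod2 (\pi_(domino_group) s) = (size (val s))%:R.
Proof. exact: homotopic_size (repr_pi1 s). Qed.

Lemma length_mod2M : {morph length_mod2 : g h / (g * h)%g >-> g + h}.
Proof. by move=> g h; rewrite [LHS]length_mod2E size_cat natrD. Qed.

Definition even_pred : pred domino_group := fun g => length_mod2 g == 0.

Fact even_pred_closed : group_closed even_pred.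
Proof.
have l1 : length_mod2 1%g = 0 by rewrite [LHS]length_mod2E.
have lV g : length_mod2 (g^-1)%g = - length_mod2 g.
  by apply/eqP; rewrite -addr_eq0 -length_mod2M mulVg l1.
split=> [|g h]; rewrite /even_pred !unfold_in /= ?l1 // => /eqP g0 /eqP h0.
by rewrite length_mod2M lV g0 h0 subrr.
Qed.

Definition even_domino_group := {g : domino_group | even_pred g}.

HB.instance Definition _ := SubChoice.on even_domino_group.
HB.instance Definition _ := SubChoice_isSubGroup.Build
  domino_group even_pred even_domino_group even_pred_closed.

Definition strongly_irregular : Prop :=
  exists phi : {multiplicative even_domino_group -> F2},
    forall w : F2, exists g : even_domino_group, phi g = w.

End Disk.

(* Not imported earlier: their notations shadow those of finset. *)
From mathcomp Require Import classical_sets reals topology normedtype.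
Import numFieldNormedType.Exports.

Section Probability.
Variables (R : realType) (D : {fset int * int}) (N : nat).

Definition uniform_weight (t : cylinder_tiling D N) : R :=
  #|{: cylinder_tiling D N}|%:R^-1.

(* P(T1 ~ T2) for the product of two uniform distributions; it is 0 when the
   cylinder has no tiling. *)
Definition prob_flip_equiv : R :=
  \sum_(t : cylinder_tiling D N * cylinder_tiling D N | flip_equiv t.1 t.2)
     uniform_weight t.1 * uniform_weight t.2.

End Probability.

Section Topology.
Local Open Scope classical_set_scope.
Variable R : realType.

Definition homeomorphic (S T : topologicalType) (A : set S) (B : set T)
    : Prop :=
  exists (f : S -> T) (g : T -> S),
    [/\ {within A, continuous f}, {within B, continuous g},
        f @` A `<=` B /\ g @` B `<=` A,
        forall x, A x -> g (f x) = x & forall y, B y -> f (g y) = y].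

Definition unit_square (a : int * int) : set (R * R) :=
  [set z | a.1%:~R <= z.1 <= (a.1 + 1)%:~R /\ a.2%:~R <= z.2 <= (a.2 + 1)%:~R].

Definition region (D : {fset int * int}) : set (R * R) :=
  \bigcup_(a in [set` D]) unit_square a.

Definition closed_unit_disk : set (R * R) := [set z | z.1 ^+ 2 + z.2 ^+ 2 <= 1].

Definition quadriculated_disk (D : {fset int * int}) : Prop :=
  homeomorphic (region D) closed_unit_disk.

End Topology.

(* Main.v *)
(* A tiling of D x [0, N] is a closed walk of length N at the empty plug, and a
   flip does not change the homotopy class of that walk. So it is enough to bound
   the l2-norm of the image in F2, under the given surjection, of a uniformly
   random closed walk. Pick three even loops at the empty plug, of the same
   length, whose images are 1, a and b, the last two being free generators. As F2
   is not amenable, the operator 1 + a + b has norm < 3 on l2(F2). Between any two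
   plugs joined by a walk of a suitable fixed length L, three walks of length L
   differ only by these loops; the norm of the walk-counting function thus grows,
   over each block of L floors, by a factor at most b < 1 times the growth of the
   number of walks. Hence the probability is at most b ^ (N / L). *)
Require Import Defs.
From mathcomp Require Import all_boot all_order all_algebra finmap.
From mathcomp Require Import generic_quotient boolp ring lra zify.
From Stdlib Require Import Relation_Operators.

Set Implicit Arguments.
Unset Strict Implicit.
Unset Printing Implicit Defensive.

Import Order.TTheory GRing.Theory Num.Theory.

(** * Spectral gap of the free group *)

(** The probability that two independent random walks have the same image is the squared l2-norm of
    the distribution of that image; this is why the l2-norm is the quantity to bound. That the norm
    of 1 + a + b is below 3 is proved directly on the Cayley tree, with an explicit constant. Two
    obstacles shape the induction over blocks. An image in F2 exists only for closed walks at the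
    empty plug, and only for those of even length, whereas cutting a walk into blocks leaves pieces
    between arbitrary plugs. Each piece is therefore studied behind a fixed prefix from the empty
    plug, with a condition on the parity of the total length. Moreover the block length must be the
    same for all pairs of plugs, although two plugs may be joined by walks of one parity only; hence
    walks are shortened and padded without changing their parity. In each block the gain comes from
    three walks only, all others being handled by the triangle inequality. The gain is thus shared
    among all walks of the block, whose number is bounded independently of N; so b may be close to 1
    but does not depend on N. *)

Section HeadLetter.
Variable X : choiceType.
Notation letter := (X * bool)%type.
Implicit Types (l : letter) (w s : seq letter) (g : free_group X).

Definition push l w :=
  if w is l' :: w' then if l' == letter_inv l then w' else l :: w else [:: l].

Definition reduced w : bool := sorted (fun l l' => l' != letter_inv l) w.

Definition reduce s := foldr push [::] s.

Lemma push_reduced l w : reduced w -> reduced (push l w).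
Proof.
rewrite /reduced; case: w => [//|l' w] /= rw; case: ifPn => [_|ne].
  exact: path_sorted rw.
by rewrite /= ne.
Qed.

Lemma reduce_reduced s : reduced (reduce s).
Proof. by elim: s => //= l s /push_reduced. Qed.

(** Letters act on reduced words by mutually inverse maps. This is van der Waerden's trick:
    inserting a cancelling pair cannot change the reduced word, and no confluence argument is
    required. *)
Lemma push_inv l w : reduced w -> push l (push (letter_inv l) w) = w.
Proof.
case: w => [|l' w] /=; first by rewrite eqxx.
rewrite letter_invK; case: (eqVneq l' l) => [->|ne] /=; last by rewrite eqxx.
by case: w => [//|l'' w] /= /andP[/negbTE->].
Qed.

Lemma reduce_equiv s t : free_equiv s t -> reduce s = reduce t.
Proof.
elim=> [a b [s1 [c [s2 [[l ->] -> ->]]]]|//|a b _ ->//|a b c _ -> _ ->//].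
by rewrite /reduce !foldr_cat /= push_inv // reduce_reduced.
Qed.

(** The first letter of the reduced word, that is, the edge from [g] towards the root of the Cayley
    tree; [None] at the root 1. *)
Definition head_letter g : option letter := ohead (reduce (repr g)).

Lemma head_letterE s : head_letter (\pi_(free_group X)%qT s) = ohead (reduce s).
Proof. by rewrite /head_letter (reduce_equiv (repr_free s)). Qed.

Definition gen l : free_group X := (\pi_(free_group X) [:: l])%qT.

(* Left multiplication by l moves g to a neighbour in the Cayley tree: the
   neighbour is the parent of g iff g starts with l^-1, and a child otherwise. *)
Lemma head_gen_mul l g :
  (head_letter (gen l * g)%g == Some l)
  = (head_letter g != Some (letter_inv l)).
Proof.
have [s ->] := free_piP g; rewrite [(_ * _)%g]free_mulE !head_letterE /=.
move: (reduce_reduced s); case: (reduce s) => [|l' w] /=; first by rewrite eqxx.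
rewrite (inj_eq Some_inj); case: (eqVneq l' (letter_inv l)) => [->|ne] /=.
  rewrite /reduced /=.
  case: w => [|l'' w] /=; first by [].

  by rewrite letter_invK (inj_eq Some_inj) => /andP[/negbTE].
by rewrite eqxx.
Qed.

Lemma head_letter1 : head_letter 1%g = None.
Proof. by rewrite [LHS]head_letterE. Qed.

Lemma head_gen l : head_letter (gen l) = Some l.
Proof. by rewrite head_letterE. Qed.

End HeadLetter.

Local Open Scope ring_scope.

(** * Counting functions of lists and their l2-norms *)

Section Collisions.
Variables (R : realFieldType) (T : eqType).
Implicit Types (s t U W : seq T) (A B : R).

(* The squared l2-norm of the function x |-> count_mem x s. *)
Definition sqnorm s : R := \sum_(x <- undup s) (count_mem x s)%:R ^+ 2.

(** Functions of finite support on a possibly infinite type are summed over duplicate-free lists;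
    this passes from one such list to another that contains the relevant part of the support. *)
Lemma ler_sum_uniq (U W : seq T) (H : T -> R) :
  uniq U -> uniq W -> (forall x, 0 <= H x) ->
  (forall x, x \in U -> x \notin W -> H x = 0) ->
  \sum_(x <- U) H x <= \sum_(x <- W) H x.
Proof.
move=> uU uW H0 HU.
rewrite (bigID (mem W)) /= [X in _ + X]big1_seq ?addr0; last first.
  by move=> x /andP[xW xU]; apply: HU.
rewrite -big_filter.
have -> : \sum_(x <- [seq x <- U | x \in W]) H x
        = \sum_(x <- [seq x <- W | x \in U]) H x.
  apply: perm_big; apply: uniq_perm; rewrite ?filter_uniq // => x.
  by rewrite !mem_filter andbC.
by rewrite big_filter [leRHS](bigID (mem U)) /= lerDl sumr_ge0.
Qed.

Lemma sqnormE s U : uniq U -> {subset s <= U} ->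
  sqnorm s = \sum_(x <- U) (count_mem x s)%:R ^+ 2.
Proof.
move=> uU sU; apply/eqP; rewrite eq_le; apply/andP; split.
  apply: ler_sum_uniq; rewrite ?undup_uniq // => x; first exact: sqr_ge0.
  by rewrite mem_undup => /sU ->.
apply: ler_sum_uniq; rewrite ?undup_uniq // => x; first exact: sqr_ge0.
by rewrite mem_undup => _ /count_memPn ->; rewrite expr0n.
Qed.

Lemma sqnorm_perm s t : perm_eq s t -> sqnorm s = sqnorm t.
Proof.
move=> st; rewrite (@sqnormE t (undup s)) ?undup_uniq //.
  by apply: eq_bigr => x _; rewrite (permP st).
by move=> x; rewrite mem_undup (perm_mem st).
Qed.

Lemma sqnorm_nil : sqnorm [::] = 0.
Proof. exact: big_nil. Qed.

Lemma sqnorm_eq0 s : sqnorm s <= 0 -> s = [::].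
Proof.
case: s => [//|x s]; rewrite leNgt /sqnorm => /negP[].
rewrite (bigD1_seq x) ?undup_uniq ?mem_undup ?mem_head //=.
by rewrite ltr_pwDl ?sumr_ge0 // => [|y _]; rewrite ?sqr_ge0 // eqxx exprn_gt0.
Qed.

(** Bounds the l2-norm itself, for which the triangle inequality holds, without taking a square root
    in the field [R]. *)
Definition norm_le s A := 0 <= A /\ sqnorm s <= A ^+ 2.

Lemma norm_le_nil : norm_le [::] 0.
Proof. by rewrite /norm_le sqnorm_nil expr0n. Qed.

Lemma norm_leW s A B : norm_le s A -> A <= B -> norm_le s B.
Proof.
move=> [A0 sA] AB; split; first exact: le_trans AB.
by apply: le_trans sA _; rewrite ler_pXn2r // nnegrE (le_trans A0).
Qed.

Lemma norm_le_perm s t A : perm_eq s t -> norm_le s A -> norm_le t A.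
Proof. by rewrite /norm_le => /sqnorm_perm->. Qed.

(** The triangle inequality: concatenating lists adds their counting functions. *)
Lemma norm_le_cat s t A B :
  norm_le s A -> norm_le t B -> norm_le (s ++ t) (A + B).
Proof.
move=> [A0 sA] [B0 tB]; have AB0 := addr_ge0 A0 B0; split=> //.
(* The weights used below divide by [A] and [B], so zero bounds, which force an empty list, are
   treated apart. *)
have [A0'|Ane] := eqVneq A 0.
  by move: sA; rewrite A0' expr0n => /sqnorm_eq0->; rewrite add0r.
have [B0'|Bne] := eqVneq B 0.
  by move: tB; rewrite B0' expr0n => /sqnorm_eq0->; rewrite cats0 addr0.
have {Ane}A0 : 0 < A by rewrite lt_def Ane.
have {Bne}B0 : 0 < B by rewrite lt_def Bne.
pose U := undup (s ++ t).
have uU : uniq U := undup_uniq _.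
have sU : {subset s <= U} by move=> x xs; rewrite mem_undup mem_cat xs.
have tU : {subset t <= U} by move=> x xt; rewrite mem_undup mem_cat xt orbT.
move: sA tB; rewrite (sqnormE uU sU) (sqnormE uU tU) => sA tB.
(* Minkowski: [(f + g)^2 <= (1 + B / A) f^2 + (1 + A / B) g^2] pointwise *)
apply: (@le_trans _ _ ((1 + B / A) * (\sum_(x <- U) (count_mem x s)%:R ^+ 2)
   + (1 + A / B) * (\sum_(x <- U) (count_mem x t)%:R ^+ 2))).
  rewrite !mulr_sumr -big_split /= /sqnorm -/U; apply: ler_sum => x _.
  rewrite count_cat natrD; set f := _%:R; set g := _%:R.
  rewrite -subr_ge0.
  have -> : (1 + B / A) * f ^+ 2 + (1 + A / B) * g ^+ 2 - (f + g) ^+ 2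
    = (B * f - A * g) ^+ 2 / (A * B) by field; rewrite !gt_eqF.
  by apply: divr_ge0; [exact: sqr_ge0 | apply: mulr_ge0; exact: ltW].
have -> : (A + B) ^+ 2 = (1 + B / A) * A ^+ 2 + (1 + A / B) * B ^+ 2.
  by field; rewrite !gt_eqF.
by apply: lerD; apply: ler_wpM2l => //; apply: addr_ge0 => //;
  apply: divr_ge0; exact: ltW.
Qed.

Lemma norm_le_flatten (I : eqType) (r : seq I) (F : I -> seq T) (A : I -> R) :
  {in r, forall i, norm_le (F i) (A i)} ->
  norm_le (flatten [seq F i | i <- r]) (\sum_(i <- r) A i).
Proof.
elim: r => [|i r IHr] FA /=; first by rewrite big_nil; apply: norm_le_nil.
rewrite big_cons; apply: norm_le_cat; first by apply: FA; rewrite mem_head.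
by apply: IHr => j jr; apply: FA; rewrite inE jr orbT.
Qed.

(** The square of a multiplicity counts ordered pairs of indices with that common value. This turns
    a norm bound into a bound on the probability of a coincidence. *)
Lemma sqnorm_collisions (I : finType) (F : I -> T) :
  sqnorm [seq F i | i <- enum I] = \sum_i \sum_j (F i == F j)%:R.
Proof.
set s := map _ _.
have cE x : (count_mem x s)%:R = \sum_i (F i == x)%:R :> R.
  rewrite count_map -sum1_count natr_sum big_mkcond big_enum /=.
  by apply: eq_bigr => i _; case: eqP.
rewrite /sqnorm (eq_bigr (fun x => \sum_i (F i == x)%:R * (count_mem x s)%:R)).
  rewrite exchange_big /=; apply: eq_bigr => i _.
  rewrite (bigD1_seq (F i)) ?undup_uniq ?mem_undup //=; last first.
    by apply: map_f; rewrite mem_enum.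
  rewrite eqxx mul1r big1 ?addr0 => [|x /negbTE xi].
    by rewrite cE; apply: eq_bigr => j _; rewrite eq_sym.
  by rewrite eq_sym xi mul0r.
by move=> x _; rewrite -mulr_suml -cE expr2.
Qed.

End Collisions.

Lemma sqnorm_map (R : realFieldType) (T S : eqType) (g : T -> S) s :
  injective g -> sqnorm R (map g s) = sqnorm R s.
Proof.
move=> gI; rewrite (@sqnormE _ _ _ (map g (undup s))) ?map_inj_uniq ?undup_uniq //.
  rewrite big_map; apply: eq_bigr => x _; rewrite count_map.
  by congr (_%:R ^+ 2); apply: eq_count => y /=; rewrite (inj_eq gI).
by move=> _ /mapP[x xs ->]; rewrite map_f // mem_undup.
Qed.

(** * The inequality for 1 + a + b on the Cayley tree *)

Section SpectralGap.
Variable R : realFieldType.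
Implicit Types (s : seq F2).

Lemma count_mulg (g x : F2) s :
  count_mem x [seq (g * y)%g | y <- s] = count_mem (g^-1 * x)%g s.
Proof.
rewrite count_map; apply: eq_count => y /=.
by apply/eqP/eqP => [<-|->]; rewrite ?mulKg ?mulVKg.
Qed.

(** Substitution of [g * y] for [x]. It is only an inequality because [U] may miss a part of the
    translated support. *)
Lemma sum_translate (g : F2) s (U : seq F2) (c : F2 -> R) : uniq U ->
  (forall x, 0 <= c x) ->
  \sum_(x <- U) c x * (count_mem (g^-1 * x)%g s)%:R ^+ 2
  <= \sum_(x <- undup s) c (g * x)%g * (count_mem x s)%:R ^+ 2.
Proof.
move=> uU c0.
pose H y := c (g * y)%g * (count_mem y s)%:R ^+ 2.
rewrite (eq_bigr (fun x => H (g^-1 * x)%g)); last by move=> x _; rewrite /H mulVKg.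
rewrite -(big_map (fun x => g^-1 * x)%g xpredT H).
apply: ler_sum_uniq; rewrite ?undup_uniq ?map_inj_uniq //; first exact: mulgI.
  by move=> x; rewrite /H mulr_ge0 ?sqr_ge0.
by move=> x _; rewrite mem_undup /H => /count_memPn ->; rewrite expr0n mulr0.
Qed.

(* Each Cayley edge is weighted by 2 at its child and by 1/2 at its parent: a
   vertex then gets at most 2 + 3/2 from its four edges, less than 4. *)
Lemma sqnorm_gap s :
  2 * sqnorm R (s ++ [seq (gen (false, false) * x)%g | x <- s]
                 ++ [seq (gen (true, false) * x)%g | x <- s])
  <= 17 * sqnorm R s.
Proof.
set a := gen _; set b := gen (true, _).
pose S := s ++ [seq a * x | x <- s]%g ++ [seq b * x | x <- s]%g.
pose U := undup S.
have uU : uniq U := undup_uniq _.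
have sU : {subset S <= U} by move=> x; rewrite mem_undup.
pose c l (x : F2) : R := if head_letter x == Some l then 2 else 1 / 2.
have c0 l x : 0 < c l x by rewrite /c; case: ifP => _; lra.
rewrite (sqnormE R uU sU) mulr_sumr.
pose f x : R := (count_mem x s)%:R.
apply: (@le_trans _ _ (2 * (\sum_(x <- U) (1 + c (false, false) x + c (true, false) x) * f x ^+ 2)
  + 2 * (\sum_(x <- U) (2 + (c (false, false) x)^-1) * f (a^-1 * x)%g ^+ 2)
  + 2 * (\sum_(x <- U) (2 + (c (true, false) x)^-1) * f (b^-1 * x)%g ^+ 2))).
  rewrite !mulr_sumr -!big_split; apply: ler_sum => x _ /=.
  rewrite /S !count_cat !count_mulg !natrD -!/(f _).
  have AM l u v : 2 * (u * v) <= c l x * u ^+ 2 + (c l x)^-1 * v ^+ 2.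
    rewrite /c -subr_ge0; case: ifP => _.
      have -> : 2 * u ^+ 2 + 2^-1 * v ^+ 2 - 2 * (u * v) = (2 * u - v) ^+ 2 / 2.
        by field.
      by rewrite divr_ge0 ?sqr_ge0.
    have -> : 1 / 2 * u ^+ 2 + (1 / 2)^-1 * v ^+ 2 - 2 * (u * v)
            = (u - 2 * v) ^+ 2 / 2 by field.
    by rewrite divr_ge0 ?sqr_ge0.
  move: (AM (false, false) (f x) (f (a^-1 * x)%g)).
  move: (AM (true, false) (f x) (f (b^-1 * x)%g)).
  (* The product of the two translates is bounded without weights. With the three diagonal squares
     this contributes 1 + 2 + 2 = 5 per vertex, and the weighted edges at most 7/2, whence 17/2. *)
  move: (sqr_ge0 (f (a^-1 * x)%g - f (b^-1 * x)%g)).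
  rewrite /f; lra.
rewrite -!mulrDr (_ : 17 * _ = 2 * (17 / 2 * sqnorm R s)); last by field.
rewrite ler_wpM2l // [in leRHS]/sqnorm mulr_sumr.
have c1 l x : 0 <= 2 + (c l x)^-1 by rewrite addr_ge0 // invr_ge0 ltW.
have := sum_translate a s uU (c1 (false, false)).
have := sum_translate b s uU (c1 (true, false)).
have : \sum_(x <- U) (1 + c (false, false) x + c (true, false) x) * f x ^+ 2
    <= \sum_(x <- undup s) (1 + c (false, false) x + c (true, false) x) * f x ^+ 2.
  apply: ler_sum_uniq; rewrite ?undup_uniq // => x.
    by rewrite mulr_ge0 ?sqr_ge0 // !addr_ge0 // ltW.
  by rewrite /f mem_undup => _ /count_memPn ->; rewrite expr0n mulr0.
move=> le1 le2 le3; apply: (le_trans (lerD (lerD le1 le3) le2)).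
rewrite -!big_split /=; apply: ler_sum => x _; rewrite -/(f x) -!mulrDl.
rewrite ler_wpM2r ?sqr_ge0 // /c !head_gen_mul.
case: (head_letter x) => [[[] []]|] /=; lra.
Qed.

End SpectralGap.

(** * Contraction along walks in a finite graph *)

Section FiniteWalks.
Variables (V E : finType) (src tgt : E -> V) (rv : E -> E).
Hypotheses (src_rv : forall e, src (rv e) = tgt e)
           (tgt_rv : forall e, tgt (rv e) = src e).
Implicit Types (n : nat) (x y z : V) (s t u w : seq E).

Fixpoint ewalk x s y : bool :=
  if s is e :: s' then (src e == x) && ewalk (tgt e) s' y else x == y.

Lemma ewalk_cat x s z t y : ewalk x s z -> ewalk z t y -> ewalk x (s ++ t) y.
Proof. by elim: s x => [|e s IHs] x /=; [move/eqP-> | case/andP=> -> /IHs]. Qed.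

Lemma ewalk_split x s t y :
  ewalk x (s ++ t) y -> exists2 z, ewalk x s z & ewalk z t y.
Proof.
elim: s x => [|d s IHs] x /=; first by exists x.
by case/andP=> -> /IHs[z]; exists z.
Qed.

Lemma ewalk_end x s y z : ewalk x s y -> ewalk x s z -> y = z.
Proof.
elim: s x => [|d s IHs] x /=; first by move=> /eqP-> /eqP.
by case/andP=> _ sy /andP[_ sz]; apply: IHs sy sz.
Qed.

Lemma ewalk_rev x s y : ewalk x s y -> ewalk y (rev (map rv s)) x.
Proof.
elim: s x => [|e s IHs] x /=; first by rewrite eq_sym.
case/andP=> /eqP<- /IHs ws; rewrite rev_cons -cats1.
by apply: ewalk_cat ws _; rewrite /= src_rv tgt_rv !eqxx.
Qed.

(** The walk is lifted to the double cover [V * bool], whose second component records the parity of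
    the number of steps; a path without repetition there visits at most [2 * #|V|] vertices. *)
Lemma ewalk_shorten x s y : ewalk x s y ->
  exists t, [/\ ewalk x t y, (size t <= 2 * #|V|)%N & odd (size t) = odd (size s)].
Proof.
pose r (a b : V * bool) :=
  [exists e, (src e == a.1) && (tgt e == b.1)] && (b.2 == ~~ a.2).
have walk_conn x' s' b : ewalk x' s' y ->
    connect r (x', b) (y, b (+) odd (size s')).
  elim: s' x' b => [|e s' IHs] x' b /=; first by move/eqP->; rewrite addbF.
  move=> /andP[/eqP<- ws]; have := IHs _ (~~ b) ws.
  rewrite addNb addbN => h; apply: connect_trans h; apply: connect1.
  by rewrite /r /= eqxx andbT; apply/existsP; exists e; rewrite !eqxx.
have path_walk a p : path r a p ->
    exists t, [/\ size t = size p, ewalk a.1 t (last a p).1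
      & (last a p).2 = a.2 (+) odd (size t)].
  elim: p a => [|b p IHp] a /=; first by exists [::]; rewrite /= eqxx addbF.
  case/andP=> /andP[/existsP[e /andP[/eqP se /eqP te]] /eqP b2].
  move=> /IHp[t [st wt lt]]; exists (e :: t); split=> /=.
  - by rewrite st.
  - by rewrite se te eqxx.
  - by rewrite lt b2 addNb addbN.
move=> /(walk_conn _ _ false) /connectP[p rp]; rewrite addFb.
case/shortenP: rp => p' rp' Up' _ lp'.
have [t [st wt lt]] := path_walk _ _ rp'.
move: wt lt; rewrite -lp' /= => wt ->; exists t; split=> //.
rewrite st mulnC -card_bool -card_prod ltnW //.
by move/card_uniqP: Up' => /= <-; apply: max_card.
Qed.

(** After shortening, the missing even length is filled by going back and forth along the first
    edge; a nonempty walk is what provides such an edge at [x]. *)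
Lemma ewalk_resize x s y n : ewalk x s y -> (0 < size s)%N ->
  odd n = odd (size s) -> (2 * #|V| <= n)%N ->
  exists2 t, ewalk x t y & size t = n.
Proof.
case: s => [//|e s] ws _ on len; have /andP[/eqP se _] := ws.
have [t [wt st ot]] := ewalk_shorten ws.
exists (flatten (nseq (n - size t)./2 [:: e; rv e]) ++ t).
  apply: ewalk_cat wt; elim: _./2 => [|m IHm] /=; first by rewrite eqxx.
  by rewrite se src_rv tgt_rv se !eqxx.
have tn := leq_trans st len.
have o2 : ~~ odd (n - size t) by rewrite oddB // ot on addbb.
rewrite size_cat size_flatten /shape map_nseq sumn_nseq /= mul2n.
by rewrite even_halfK // subnK.
Qed.

Definition walks n x y : seq (seq E) :=
  [seq val v | v <- enum {: n.-tuple E} & ewalk x (val v) y].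

Lemma mem_walks n x y s : (s \in walks n x y) = (size s == n) && ewalk x s y.
Proof.
apply/mapP/andP => [[t]|[/eqP sn ws]].
  by rewrite mem_filter => /andP[wt _] ->; rewrite size_tuple eqxx.
have sT : size s == n by apply/eqP.
by exists (Tuple sT); rewrite // mem_filter mem_enum /= ws.
Qed.

Lemma walks_uniq n x y : uniq (walks n x y).
Proof. by rewrite (map_inj_uniq val_inj) filter_uniq ?enum_uniq. Qed.

Lemma size_walks_le n x y : (size (walks n x y) <= #|E| ^ n)%N.
Proof.
rewrite size_map size_filter (leq_trans (count_size _ _)) //.
by rewrite -cardE card_tuple.
Qed.

Lemma walks_cat m n x y : perm_eq (walks (m + n) x y)
  [seq v | z <- enum V, v <- [seq u ++ w | u <- walks m x z, w <- walks n z y]].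
Proof.
apply: uniq_perm; first exact: walks_uniq.
  apply: allpairs_uniq_dep; first exact: enum_uniq.
    move=> z _; apply: allpairs_uniq; rewrite ?walks_uniq //.
    move=> [u w] [u' w'] /allpairsP[[? ?] /= [mu _ [-> _]]].
    move=> /allpairsP[[? ?] /= [mu' _ [-> _]]].
    move: mu mu'; rewrite !mem_walks => /andP[/eqP su _] /andP[/eqP su' _].
    by move=> /eqP; rewrite eqseq_cat ?su // => /andP[/eqP-> /eqP->].
  move=> _ _ /allpairsPdep[z [v [_ + ->]]] /allpairsPdep[z' [v' [_ + ->]]] /=.
  move=> /allpairsP[[u w] /= [mu _ ->]] /allpairsP[[u' w'] /= [mu' _ ->]].
  move: mu mu'; rewrite !mem_walks => /andP[/eqP su wu] /andP[/eqP su' wu'].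
  move=> e; have /andP[/eqP eu _] : (u == u') && (w == w').
    by rewrite -eqseq_cat ?su ?su' //; apply/eqP.
  by move: e; rewrite (ewalk_end wu (z := z')) ?eu // => ->.
move=> s; rewrite mem_walks; apply/andP/allpairsPdep.
  move=> [/eqP sz ws]; have := ws; rewrite -{1}(cat_take_drop m s).
  move=> /ewalk_split[z w1 w2]; exists z, s; rewrite mem_enum; split=> //.
  apply/allpairsP; exists (take m s, drop m s) => /=.
  rewrite !mem_walks w1 w2 cat_take_drop size_takel ?sz ?leq_addr //.
  by rewrite size_drop sz addKn !eqxx.
move=> [z [v [_ /allpairsP[[u w] /= [mu mw ->]] ->]]].
move: mu mw; rewrite !mem_walks => /andP[/eqP su wu] /andP[/eqP sw ww].
by rewrite size_cat su sw eqxx; split=> //; apply: ewalk_cat wu ww.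
Qed.

End FiniteWalks.

Section NormBounds.
Variable R : realFieldType.

(** Each entry adds at most 1 to the norm. This trivial bound starts the induction over the
    blocks. *)
Lemma norm_le_size (T : eqType) (s : seq T) : norm_le s ((size s)%:R : R).
Proof.
elim: s => [|x s IHs]; first exact: norm_le_nil.
rewrite -cat1s size_cat natrD; apply: norm_le_cat IHs; split=> //.
by rewrite /sqnorm /= big_seq1 /= eqxx.
Qed.

Lemma norm_le_mulg (g : F2) s (A : R) :
  norm_le s A -> norm_le [seq (g * x)%g | x <- s] A.
Proof. by rewrite /norm_le sqnorm_map //; apply: mulgI. Qed.

(** The constant [73 / 25] is a rational number slightly above the square root of [17 / 2] and still
    below 3. *)
Lemma norm_le_gap s (A : R) : norm_le s A ->
  norm_le (s ++ [seq (gen (false, false) * x)%g | x <- s]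
             ++ [seq (gen (true, false) * x)%g | x <- s]) (73 / 25 * A).
Proof.
move=> [A0 sA]; split; first by rewrite mulr_ge0 //; lra.
have := sqnorm_gap R s; have := sqr_ge0 A; rewrite exprMn; lra.
Qed.

End NormBounds.

Section WalkContraction.
Variables (V E : finType) (src tgt : E -> V) (rv : E -> E).
Hypotheses (src_rv : forall e, src (rv e) = tgt e)
           (tgt_rv : forall e, tgt (rv e) = src e).
Variables (x0 : V) (Phi : seq E -> F2).
Local Notation ewalk := (ewalk src tgt).
Local Notation walks := (walks src tgt).
Hypothesis PhiM : forall s t, ewalk x0 s x0 -> ewalk x0 t x0 ->
  ~~ odd (size s) -> ~~ odd (size t) -> Phi (s ++ t) = (Phi s * Phi t)%g.
Hypothesis Phi_rv : forall e, src e = x0 -> Phi [:: e; rv e] = 1%g.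
Hypothesis Phi_onto : forall g,
  exists s, [/\ ewalk x0 s x0, ~~ odd (size s) & Phi s = g].

(** The padding consists of back-and-forth steps at [x0], whose image is 1 by [Phi_rv], so the
    length grows while the image stays. *)
Lemma loop_resize s n : ewalk x0 s x0 -> ~~ odd (size s) -> (0 < size s)%N ->
  ~~ odd n -> (size s <= n)%N ->
  exists t, [/\ ewalk x0 t x0, size t = n & Phi t = Phi s].
Proof.
move=> ws os s0 on sn.
have [e se] : exists e, src e = x0.
  by case: s ws s0 {os sn} => [//|e s] /= /andP[/eqP]; exists e.
have we : ewalk x0 [:: e; rv e] x0 by rewrite /= se src_rv tgt_rv se !eqxx.
rewrite -(subnKC sn) -(@even_halfK (n - _)) ?oddB ?(negbTE on) ?(negbTE os) //.
elim: _./2 => [|m [t [wt st Pt]]]; first by exists s; rewrite double0 addn0.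
exists (t ++ [:: e; rv e]); split; first exact: ewalk_cat wt we.
  by rewrite size_cat st /= doubleS !addnS addn0.
by rewrite PhiM ?Phi_rv ?mulg1 // st oddD odd_double addbF.
Qed.

Lemma generating_loops : exists M l1 l2 l3, ~~ odd M /\
  [/\ [/\ ewalk x0 l1 x0, size l1 = M & Phi l1 = 1%g],
      [/\ ewalk x0 l2 x0, size l2 = M & Phi l2 = gen (false, false)]
    & [/\ ewalk x0 l3 x0, size l3 = M & Phi l3 = gen (true, false)]].
Proof.
have Phi0 : Phi [::] = 1%g.
  by apply: (mulgI (Phi [::])); rewrite -PhiM ?mulg1 //= eqxx.
have gen_loop l : exists s, [/\ ewalk x0 s x0, ~~ odd (size s), (0 < size s)%N
    & Phi s = gen l].
  have [s [ws os Ps]] := Phi_onto (gen l); exists s; split=> //.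
  case: s Ps {ws os} => [|//]; rewrite Phi0 => /(congr1 (@head_letter _)).
  by rewrite head_letter1 head_gen.
have [s2 [w2 o2 s20 <-]] := gen_loop (false, false).
have [s3 [w3 o3 s30 <-]] := gen_loop (true, false).
have [s1 [w1 o1 s10 P1]] : exists s, [/\ ewalk x0 s x0, ~~ odd (size s),
    (0 < size s)%N & Phi s = 1%g].
  case: s2 w2 s20 {o2} => [//|e s] /= /andP[/eqP se _] _.
  exists [:: e; rv e]; rewrite Phi_rv //.
  by split; rewrite //= se src_rv tgt_rv se !eqxx.
(* An even number not smaller than any of the three lengths, so that all three loops can be padded
   to it. *)
pose M := (size s1 + size s2 + size s3)%N.
have oM : ~~ odd M by rewrite !oddD (negbTE o1) (negbTE o2) (negbTE o3).
have [l1 [? ? e1]] := loop_resize w1 o1 s10 oM ltac:(lia).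
have [l2 [? ? e2]] := loop_resize w2 o2 s20 oM ltac:(lia).
have [l3 [? ? e3]] := loop_resize w3 o3 s30 oM ltac:(lia).
by exists M, l1, l2, l3; rewrite e1 e2 e3 P1.
Qed.

(* Any completion of the partial walks is allowed, as changing it only
   translates the values of Phi. *)
Lemma walk_norm_contraction (R : realFieldType) :
  exists L (b : R), [/\ (0 < L)%N, 0 < b < 1 & forall k r x s,
    ewalk x0 s x -> ~~ odd (size s + (k * L + r)) ->
    norm_le [seq Phi (s ++ w) | w <- walks (k * L + r) x x0]
            (b ^+ k * (size (walks (k * L + r) x x0))%:R)].
Proof.
have [M [l1 [l2 [l3 [oM [[w1 s1 P1] [w2 s2 P2] [w3 s3 P3]]]]]]] := generating_loops.
have l12 : l1 != l2.
  apply/eqP => e; move/(congr1 (@head_letter _)): P2.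
  by rewrite -e P1 head_letter1 head_gen.
have l13 : l1 != l3.
  apply/eqP => e; move/(congr1 (@head_letter _)): P3.
  by rewrite -e P1 head_letter1 head_gen.
have l23 : l2 != l3.
  apply/eqP => e; move/(congr1 (@head_letter _)): P3.
  by rewrite -e P2 !head_gen.
have V0 : (0 < #|V|)%N by apply/card_gt0P; exists x0.
(* Room for a short walk to [x0] (at most [2 * #|V|]), a loop of length [M], the way back (again
   [2 * #|V|]), and a walk on to the target, for which [ewalk_resize] asks at least [2 * #|V|]. *)
pose L := (M + 6 * #|V|)%N; have L0 : (0 < L)%N by rewrite /L; lia.
pose C : R := (#|E| ^ L).+1%:R; have C1 : 1 <= C by rewrite ler1n.
have C0 : 0 < C by apply: lt_le_trans C1.
(* Three walks gain [3 - 73 / 25 = 2 / 25]. As a block has at most [C] walks between two given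
   vertices, this is a proportion of at least [(2 / 25) / C] of their number. *)
pose b : R := 1 - (2 / 25) / C.
have b01 : 0 < b < 1.
  have : 0 < (2 / 25) / C by apply: divr_gt0 => //; lra.
  have : (2 / 25) / C < 1 by rewrite ltr_pdivrMr // mul1r; apply: lt_le_trans C1; lra.
  by rewrite /b; move: (_ / C) => d d0 d1; apply/andP; split; lra.
exists L, b; split=> // k r; elim: k => [|k IHk] x s wsx os.
  by rewrite expr0 mul1r -(size_map (fun w => Phi (s ++ w))); apply: norm_le_size.
have -> : (k.+1 * L + r = L + (k * L + r))%N by rewrite mulSn addnA.
set n := (k * L + r)%N in IHk *.
have on : odd (size s + L) = odd n.
  by move: os; rewrite mulSn -addnA -/n addnA oddD => /negPn; case: odd; case: odd.
have [b0 _] := andP b01.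
have pW := walks_cat src tgt L n x x0.
rewrite (perm_size pW) size_flatten; apply: norm_le_perm.
  by rewrite perm_sym; apply: perm_map; exact: pW.
rewrite /shape sumnE !big_map natr_sum mulr_sumr map_flatten -map_comp.
rewrite -enumT; apply: norm_le_flatten => z _ /=; rewrite map_id size_allpairs.
set A := walks L x z; set W := walks n z x0; set X := b ^+ k * (size W)%:R.
have -> : b ^+ k.+1 * (size A * size W)%:R = b * (size A)%:R * X.
  by rewrite exprS natrM /X; ring.
have X0 : 0 <= X by rewrite mulr_ge0 ?exprn_ge0 // ltW.
pose F u := [seq Phi (s ++ u ++ w) | w <- W].
have -> : [seq Phi (s ++ v) | v <- [seq u ++ w | u <- A, w <- W]]
        = flatten [seq F u | u <- A].
  rewrite map_flatten -map_comp; congr flatten; apply: eq_map => u /=.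
  by rewrite -map_comp.
have FX u : u \in A -> norm_le (F u) X.
  rewrite mem_walks => /andP[/eqP su wu].
  have := IHk z (s ++ u) (ewalk_cat wsx wu).
  rewrite size_cat su oddD on addbb => /(_ isT); congr norm_le.
  by apply: eq_map => w; rewrite catA.
case: (posnP (size A)) => [/size0nil->|].
  by rewrite mulr0 mul0r; apply: norm_le_nil.
(* A single walk [u0] of length [L] shows that [z] can be reached from [x] in the right parity,
   which is all that the construction of the three special walks needs. *)
case EA : {1}A => [//|u0 A'] _.
have : u0 \in A by rewrite EA mem_head.
rewrite mem_walks => /andP[/eqP su0 wu0].
(* [sg] returns from [x] to [x0], where a loop can be inserted; [tau] below goes back along [sg] and
   then on to [z]. As [sg] has the parity of [s], the closed walk [s ++ sg] is even and [PhiM]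
   applies to it. *)
have [sg [wsg ssg osg]] := ewalk_shorten (ewalk_rev src_rv tgt_rv wsx).
rewrite size_rev size_map in osg.
have [u' wu' su'] : exists2 u', ewalk x u' z & size u' = (L - M - 2 * size sg)%N.
  apply: (ewalk_resize src_rv tgt_rv wu0); rewrite ?su0 // /L; last by clear -ssg; lia.
  rewrite (_ : _ - _ - _ = 2 * (3 * #|V| - size sg))%N; last by clear -ssg; lia.
  by rewrite oddD !oddM (negbTE oM).
pose tau := rev (map rv sg) ++ u'.
have wtau : ewalk x0 tau z by apply: ewalk_cat wu'; apply: ewalk_rev.
have st : (size sg + M + size tau = L)%N.
  by rewrite size_cat size_rev size_map su' /L; clear -ssg; lia.
clearbody tau; clear u' wu' su'.
pose base := [seq Phi (tau ++ w) | w <- W].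
have ot : odd (size tau) = odd n.
  by move: on; rewrite -st !oddD osg (negbTE oM) addbF addbA addbb.
have baseX : norm_le base X.
  by apply: IHk => //; rewrite oddD ot addbb.
have mem_u l : ewalk x0 l x0 -> size l = M -> sg ++ l ++ tau \in A.
  move=> wl sl; rewrite mem_walks !size_cat sl addnA st eqxx.
  exact: ewalk_cat wsg (ewalk_cat wl wtau).
have mW w : w \in W -> size w = n /\ ewalk z w x0.
  by rewrite mem_walks => /andP[/eqP].
clearbody W.
(* For the three special walks the images are translates of the one list [base]: the factor
   [Phi (s ++ sg)] is common and preserves the norm, so only 1, a and b remain. *)
have F_u l : ewalk x0 l x0 -> size l = M ->
    F (sg ++ l ++ tau) = [seq (Phi (s ++ sg) * y)%g | y <- [seq (Phi l * y)%g | y <- base]].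
  move=> wl sl; rewrite /F /base -!map_comp; apply/eq_in_map => w.
  case/mW=> sw ww /=.
  have wtw := ewalk_cat wtau ww.
  have e2 : ~~ odd (size (tau ++ w)) by rewrite size_cat sw oddD ot addbb.
  have e1 : ~~ odd (size l) by rewrite sl.
  have w1' := ewalk_cat wsx wsg; have w2' := ewalk_cat wl wtw.
  have e3 : ~~ odd (size (s ++ sg)) by rewrite size_cat oddD osg addbb.
  have e4 : ~~ odd (size (l ++ tau ++ w)).
    by rewrite size_cat oddD (negbTE e1) (negbTE e2).
  by rewrite -!catA (catA s) (PhiM w1' w2' e3 e4) (PhiM wl wtw e1 e2).
pose u l := sg ++ l ++ tau.
have ne_u l l' : size l = size l' -> l != l' -> u l != u l'.
  move=> sl; rewrite /u eqseq_cat // eqxx /= eqseq_cat // => /negbTE->.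
  by [].
pose rest := rem (u l3) (rem (u l2) (rem (u l1) A)).
have pA : perm_eq A (u l1 :: u l2 :: u l3 :: rest).
  have uA : uniq A := walks_uniq src tgt L x z.
  have i2 : u l2 \in rem (u l1) A.
    by rewrite mem_rem_uniq // inE mem_u // andbT ne_u ?s1 ?s2 // eq_sym.
  have i3 : u l3 \in rem (u l2) (rem (u l1) A).
    rewrite mem_rem_uniq ?rem_uniq // inE mem_rem_uniq // inE mem_u // andbT.
    by rewrite !ne_u ?s1 ?s2 ?s3 // eq_sym.
  rewrite (permPl (perm_to_rem (mem_u _ w1 s1))) perm_cons.
  rewrite (permPl (perm_to_rem i2)) perm_cons.
  by rewrite (permPl (perm_to_rem i3)).
have sA : (size A)%:R = 3 + (size rest)%:R :> R.
  by rewrite (perm_size pA) /= -natrD.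
apply: (@norm_le_perm _ _ (flatten [seq F u | u <- u l1 :: u l2 :: u l3 :: rest])).
  by apply: perm_flatten; apply: perm_map; rewrite perm_sym.
(* The three special walks together cost [73 / 25 * X] instead of [3 * X]; every other walk costs
   [X]. *)
apply: (@norm_leW _ _ _ (73 / 25 * X + \sum_(u <- rest) X)).
  rewrite /= (catA (F (u l2))) (catA (F (u l1))); apply: norm_le_cat; last first.
    apply: norm_le_flatten => v vr; apply: FX; rewrite (perm_mem pA) !inE vr.
    by rewrite !orbT.
  rewrite !F_u // P1 P2 P3 -!map_cat; apply: norm_le_mulg.
  rewrite (_ : [seq (1 * y)%g | y <- base] = base); first exact: norm_le_gap.
  by rewrite -[RHS]map_id; apply: eq_map => y; rewrite mul1g.
rewrite big_const_seq count_predT iter_addr_0 -(mulr_natl X) -mulrDl ler_wpM2r //.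
have Ale : (size A)%:R / C <= 1.
  rewrite ler_pdivrMr // mul1r ler_nat leqW //; exact: size_walks_le.
have -> : b * (size A)%:R = (size A)%:R - 2 / 25 * ((size A)%:R / C).
  by rewrite /b; move: (size A)%:R C^-1 => a c; ring.
move: Ale sA; move: (_ / C) => q; move: (size rest)%:R (size A)%:R => r' a.
move=> q1 aE; lra.
Qed.

End WalkContraction.

(** * Tilings of cylinders as walks *)

Section TilingCriterion.
Variables (V : zmodType) (dirs : seq V) (T : finType) (pos : T -> V).
Implicit Types (A B : {set T}) (t : {set {set T}}).

Lemma is_tilingP A t : reflect
  [/\ forall B, B \in t -> is_domino dirs pos B /\ B \subset A,
      forall x, x \in A -> exists2 B, B \in t & x \in B
    & forall B B' x, B \in t -> B' \in t -> x \in B -> x \in B' -> B = B']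
  (is_tiling dirs pos A t).
Proof.
apply: (iffP andP) => [[/and3P[/eqP cA tI n0] /forall_inP dom]|[dom cov un]].
  split=> [B tB|x|B B' x tB tB' xB xB'].
  - by split; [apply: dom | rewrite -cA; apply: bigcup_sup].
  - by rewrite -cA => /bigcupP[B]; exists B.
  - apply/eqP/negPn/negP => /(trivIsetP tI _ _ tB tB')/disjoint_setI0/setP/(_ x).
    by rewrite !inE xB xB'.
split; last by apply/forall_inP => B /dom[].
apply/and3P; split.
- rewrite eqEsubset; apply/andP; split.
    by apply/bigcupsP => B /dom[].
  by apply/subsetP => x /cov[B tB xB]; apply/bigcupP; exists B.
- apply/trivIsetP => B B' tB tB' /eqP neB; rewrite -setI_eq0; apply/eqP/setP=> x.
  rewrite !inE; apply/andP=> -[xB xB']; exact: neB (un _ _ _ tB tB' xB xB').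
- apply/negP => /dom[/existsP[x /existsP[y /andP[_ /eqP e]]] _].
  by move/setP/(_ x): e; rewrite !inE eqxx.
Qed.

End TilingCriterion.

Section CylinderTilings.
Variables (D : {fset int * int}) (N : nat).
Implicit Types (x y : D) (d : {set D}) (k j : nat) (p q : cube D N).
Implicit Types (B : {set cube D N}) (t : {set {set cube D N}}).

Local Notation cube_tiling :=
  (is_tiling dirs3 (@cube_pos D N) [set: cube D N]).
Local Notation cube_domino := (is_domino dirs3 (@cube_pos D N)).

Lemma cube_adjacentE p q : adjacent dirs3 (@cube_pos D N) p q
  = (sq_adjacent p.1 q.1 && (p.2 == q.2))
    || (p.1 == q.1) && ((q.2 == p.2.+1 :> nat) || (p.2 == q.2.+1 :> nat)).
Proof.
have add3 (a b c a' b' c' : int) :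
  (a, b, c) + (a', b', c') = (a + a', b + b', c + c') by [].
have add2 (a b a' b' : int) : (a, b) + (a', b') = (a + a', b + b') by [].
have eqS (m n : nat) : (m%:Z == n%:Z + 1) = (m == n.+1) by lia.
case: p q => [x i] [y j]; rewrite /sq_adjacent /adjacent /= /cube_pos /sq_pos /=.
rewrite -[x == y]val_eqE -[i == j]val_eqE /=.
case: (fsval x) (fsval y) => [a b] [a' b'].
rewrite !add3 !add2 !xpair_eqE !addr0 !orbF !eqS.
rewrite (eq_sym a' a) (eq_sym b' b) !eqz_nat (eq_sym (j : nat) i).
by do ![case: (_ == _)].
Qed.

Lemma sq_adjacent_irr x : sq_adjacent x x = false.
Proof.
have neq0 (u : int * int) : (u == u + (1, 0)) = false /\ (u == u + (0, 1)) = false.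
  by case: u => a b; rewrite !xpair_eqE /=; split; lia.
by rewrite /sq_adjacent /adjacent /= !(neq0 _).1 !(neq0 _).2.
Qed.

Definition layer k d : {set cube D N} :=
  [set q : cube D N | (q.1 \in d) && (q.2 == k :> nat)].

(** The vertical domino that crosses the plane at height [k], so its cubes lie on floors [k - 1] and
    [k]. At [k = 0] and [k = N] at most one cube is left, hence no domino. *)
Definition pillar x k : {set cube D N} :=
  [set q : cube D N | (q.1 == x) && ((q.2 == k :> nat) || (q.2.+1 == k))].

Lemma layer2 (i : 'I_N) x y : layer i [set x; y] = [set (x, i); (y, i)].
Proof.
apply/setP => -[z j]; rewrite !inE !xpair_eqE /=.
by rewrite -[j == i]val_eqE; do ![case: (_ == _)].
Qed.

Lemma pillar2 x (i j : 'I_N) : j = i.+1 :> nat -> pillar x j = [set (x, i); (x, j)].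
Proof.
move=> ji; apply/setP => -[z l]; rewrite !inE !xpair_eqE /= ji eqSS.
rewrite -[l == i]val_eqE -[l == j]val_eqE /= ji orbC.
by do ![case: (_ == _)].
Qed.

Lemma planar_dominoP d : reflect (exists x y, sq_adjacent x y /\ d = [set x; y])
  (planar_domino d).
Proof.
apply: (iffP existsP) => [[x /existsP[y /andP[xy /eqP->]]]|[x [y [xy ->]]]].
  by exists x, y.
by exists x; apply/existsP; exists y; apply/andP.
Qed.

Lemma cube_dominoP B : cube_domino B ->
  (exists (i : 'I_N) d, planar_domino d /\ B = layer i d) \/
  (exists x (i j : 'I_N), j = i.+1 :> nat /\ B = pillar x j).
Proof.
case/existsP=> -[x i] /existsP[[y j] /andP[+ /eqP->]]; rewrite cube_adjacentE /=.
case/orP=> [/andP[xy /eqP<-]|/andP[/eqP<- /orP[]/eqP ij]].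
- left; exists i, [set x; y]; rewrite layer2; split=> //.
  by apply/planar_dominoP; exists x, y.
- by right; exists x, i, j; rewrite (pillar2 x ij).
- by right; exists x, j, i; rewrite (pillar2 x ij) setUC.
Qed.

Lemma layer_domino k d : (k < N)%N -> planar_domino d -> cube_domino (layer k d).
Proof.
move=> kN /planar_dominoP[x [y [xy ->]]]; rewrite (layer2 (Ordinal kN)).
apply/existsP; exists (x, Ordinal kN); apply/existsP; exists (y, Ordinal kN).
by rewrite cube_adjacentE /= xy !eqxx.
Qed.

Lemma pillar_domino x k : (0 < k < N)%N -> cube_domino (pillar x k).
Proof.
case: k => [//|k] /= kN; have kN' := ltnW kN.
rewrite (@pillar2 x (Ordinal kN') (Ordinal kN)) //.
apply/existsP; exists (x, Ordinal kN'); apply/existsP; exists (x, Ordinal kN).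
by rewrite cube_adjacentE /= !eqxx orbT.
Qed.

Lemma planar_domino_mem d : planar_domino d -> exists x, x \in d.
Proof. by case/planar_dominoP=> x [y [_ ->]]; exists x; rewrite !inE eqxx. Qed.

Lemma layer_inj k j d e x : (k < N)%N -> x \in d -> layer k d = layer j e ->
  k = j /\ d = e.
Proof.
move=> kN xd /setP E; have := E (x, Ordinal kN); rewrite !inE xd eqxx /=.
case/esym/andP=> _ /eqP kj; split=> //; apply/setP=> y.
by have := E (y, Ordinal kN); rewrite !inE /= kj eqxx !andbT.
Qed.

Lemma layer_neq_pillar k d x j : (0 < j < N)%N -> layer k d != pillar x j.
Proof.
case: j => [//|j] jN; apply/eqP => /setP E.
have := E (x, Ordinal (ltnW jN)); have := E (x, Ordinal jN).
rewrite !inE /= !eqxx !orbT /= => /andP[_ /eqP <-] /andP[_ /eqP].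
by move/n_Sn.
Qed.

Lemma pillar_inj x y k j : (0 < k < N)%N -> pillar x k = pillar y j ->
  x = y /\ k = j.
Proof.
case: k => [//|k] kN /setP E.
have := E (x, Ordinal (ltnW kN)); have := E (x, Ordinal kN).
rewrite !inE /= !eqxx !orbT /= => /esym/andP[/eqP-> k1] /esym/andP[_ k2].
by split=> //; lia.
Qed.

Definition hor t k : {set {set D}} := [set d | layer k d \in t].
Definition ver t k : {set D} := [set x | pillar x k \in t].

Section TilingFloors.
Variable t : {set {set cube D N}}.
Hypothesis tT : cube_tiling t.

Lemma tiling_domino B : B \in t -> cube_domino B.
Proof. by case/is_tilingP: tT => dom _ _ /dom[]. Qed.

Lemma tiling_cover q : exists2 B, B \in t & q \in B.
Proof. by case/is_tilingP: tT => _ cov _; apply: cov; rewrite inE. Qed.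

Lemma tiling_unique B B' q : B \in t -> B' \in t -> q \in B -> q \in B' -> B = B'.
Proof. by case/is_tilingP: tT => _ _; apply. Qed.

Lemma hor_domino d k : d \in hor t k -> planar_domino d /\ (k < N)%N.
Proof.
rewrite inE => /tiling_domino/cube_dominoP[[i [e [pe E]]]|[x [i [j [ji E]]]]].
  have [x xe] := planar_domino_mem pe.
  by have [<- <-] := layer_inj (ltn_ord i) xe (esym E); split.
have : (0 < j < N)%N by rewrite ltn_ord ji.
by move/(layer_neq_pillar k d x); rewrite E eqxx.
Qed.

Lemma ver_range x k : x \in ver t k -> (0 < k < N)%N.
Proof.
rewrite inE => /tiling_domino/cube_dominoP[[i [e [pe E]]]|[y [i [j [ji E]]]]].
  have [y [z [yz ee]]] := planar_dominoP _ pe; move/setP: E => E.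
  have := E (y, i); have := E (z, i); rewrite ee !inE /= !eqxx !orbT /=.
  case/andP=> /eqP zx _ /andP[/eqP yx _].
  by move: yz; rewrite zx yx sq_adjacent_irr.
have jN : (0 < j < N)%N by rewrite ltn_ord ji.
by have [_ <-] := pillar_inj jN (esym E).
Qed.

Lemma ver0 : ver t 0 = set0.
Proof. by apply/setP=> x; rewrite [RHS]inE; apply/negP => /ver_range. Qed.

Lemma verN : ver t N = set0.
Proof.
by apply/setP=> x; rewrite [RHS]inE; apply/negP=> /ver_range; rewrite ltnn andbF.
Qed.

Lemma disjoint_ver k : (k < N)%N -> [disjoint ver t k & ver t k.+1].
Proof.
move=> kN; rewrite -setI_eq0; apply/eqP/setP=> x; rewrite in_setI in_set0.
apply/negP=> /andP[v1 v2]; have r2 := ver_range v2; have r1 := ver_range v1.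
rewrite !inE in v1 v2; have := pillar_inj r1 (tiling_unique
  (q := (x, Ordinal kN)) v1 v2 _ _).
by rewrite !inE /= !eqxx ?orbT => /(_ isT isT)[_ /n_Sn].
Qed.

(** A cube of floor [k] outside all horizontal dominoes lies in a vertical one, which crosses either
    the lower plane (plug [k]) or the upper plane (plug [k.+1]). *)
Lemma floor_planar_tiling k : (k < N)%N ->
  planar_tiling (~: (ver t k :|: ver t k.+1)) (hor t k).
Proof.
move=> kN; apply/is_tilingP; split.
- move=> d dt; have [pd _] := hor_domino dt; split=> //.
  apply/subsetP=> x xd; rewrite !inE; rewrite inE in dt.
  have xl : (x, Ordinal kN) \in layer k d by rewrite !inE xd /=.
  apply/negP=> /orP[]v.
    have r : (0 < k < N)%N by apply: (@ver_range x); rewrite inE.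
    have := layer_neq_pillar k d x r.
    by rewrite (tiling_unique dt v xl) ?eqxx // !inE /= !eqxx.
  have r : (0 < k.+1 < N)%N by apply: (@ver_range x); rewrite inE.
  have := layer_neq_pillar k d x r.
  by rewrite (tiling_unique dt v xl) ?eqxx // !inE /= !eqxx orbT.
- move=> x; rewrite !inE negb_or => /andP[nv1 nv2].
  have [B Bt xB] := tiling_cover (x, Ordinal kN).
  have [[i [d [pd E]]]|[y [i [j [ji E]]]]] := cube_dominoP (tiling_domino Bt).
    move: xB; rewrite E inE /= => /andP[xd /eqP ki]; exists d => //.
    by rewrite inE ki -E.
  move: xB; rewrite E inE /= => /andP[/eqP xy /orP[]/eqP kj].
    by move: nv1; rewrite xy kj -E Bt.
  by move: nv2; rewrite xy kj -E Bt.
- move=> d d' x; rewrite !inE => dt dt' xd xd'.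
  have := tiling_unique (q := (x, Ordinal kN)) dt dt'; rewrite !inE /= xd xd' eqxx.
  by move=> /(_ isT isT) E; have [] := layer_inj kN xd E.
Qed.

End TilingFloors.

Section Assembly.
Variables (P : nat -> {set D}) (H : nat -> {set {set D}}).
Hypotheses (P0 : P 0%N = set0) (PN : P N = set0).
Hypothesis disjP : forall k, (k < N)%N -> [disjoint P k & P k.+1].
Hypothesis tilH : forall k, (k < N)%N ->
  planar_tiling (~: (P k :|: P k.+1)) (H k).

(** The inverse of [hor] and [ver]. Heights in ['I_N] suffice for the pillars too, because the plug
    at height [N] is empty. *)
Definition assemble : {set {set cube D N}} :=
  [set B | [exists i : 'I_N, [exists d in H i, B == layer i d]
                          || [exists x in P i, B == pillar x i]]].

Lemma assembleP B : reflect
  ((exists k d, [/\ (k < N)%N, d \in H k & B = layer k d]) \/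
   (exists k x, [/\ (0 < k < N)%N, x \in P k & B = pillar x k]))
  (B \in assemble).
Proof.
rewrite inE; apply: (iffP existsP) => [[i /orP[]]|[[k [d [kN dH ->]]]|[k [x [kN xP ->]]]]].
- by case/exists_inP=> d dH /eqP->; left; exists i, d.
- case/exists_inP=> x xP /eqP->; right; exists i, x; split=> //.
  rewrite ltn_ord andbT; case: (posnP i) xP => [->|//].
  by rewrite P0 inE.
- by exists (Ordinal kN); apply/orP; left; apply/exists_inP; exists d.
- have /andP[_ kN'] := kN; exists (Ordinal kN'); apply/orP; right.
  by apply/exists_inP; exists x.
Qed.

Lemma assemble_tiling : cube_tiling assemble.
Proof.
have domH k d : (k < N)%N -> d \in H k ->
    planar_domino d /\ d \subset ~: (P k :|: P k.+1).
  by move=> /tilH/is_tilingP[dom _ _] /dom.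
apply/is_tilingP; split.
- move=> B /assembleP[[k [d [kN /domH[] // pd _ ->]]]|[k [x [kN _ ->]]]].
    by split; [apply: layer_domino | apply: subsetT].
  by split; [apply: pillar_domino | apply: subsetT].
- move=> [x i] _; have iN := ltn_ord i.
  have [v1|nv1] := boolP (x \in P i).
    exists (pillar x i); last by rewrite !inE /= !eqxx.
    apply/assembleP; right; exists i, x; split=> //.
    by rewrite iN andbT; case: (posnP i) v1 => [->|//]; rewrite P0 inE.
  have [v2|nv2] := boolP (x \in P i.+1).
    exists (pillar x i.+1); last by rewrite !inE /= !eqxx orbT.
    apply/assembleP; right; exists i.+1, x; split=> //=.
    rewrite ltn_neqAle iN andbT; apply/eqP => iE.
    by move: v2; rewrite iE PN inE.
  have [_ cov _] := is_tilingP _ _ _ _ (tilH iN).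
  have [|d dH xd] := cov x; first by rewrite !inE negb_or nv1.
  exists (layer i d); last by rewrite !inE xd /=.
  by apply/assembleP; left; exists i, d.
have key B x (i : 'I_N) : B \in assemble -> (x, i) \in B ->
  [\/ exists d, [/\ d \in H i, x \in d, B = layer i d, x \notin P i & x \notin P i.+1],
      x \in P i /\ B = pillar x i | x \in P i.+1 /\ B = pillar x i.+1].
  case/assembleP=> [[k [d [kN dH ->]]]|[k [y [kN yP ->]]]].
    rewrite inE /= => /andP[xd /eqP ik]; constructor 1; exists d.
    have [_ /subsetP/(_ x xd)] := domH k d kN dH.
    by rewrite !inE negb_or ik => /andP[-> ->].
  rewrite inE /= => /andP[/eqP xy /orP[]/eqP ik]; subst x.
    by constructor 2; rewrite ik.
  by constructor 3; rewrite ik.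
move=> B B' [x i] tB tB' xB xB'; have iN := ltn_ord i.
have disj : x \in P i -> x \in P i.+1 -> False.
  by move=> v1 v2; have := disjointFr (disjP iN) v1; rewrite v2.
case: (key _ _ _ tB xB) => [[d [dH xd -> n1 n2]]|[v1 ->]|[v2 ->]];
case: (key _ _ _ tB' xB') => [[d' [dH' xd' -> n1' n2']]|[v1' ->]|[v2' ->]] //.
- have [_ _ un] := is_tilingP _ _ _ _ (tilH iN).
  by rewrite (un d d' x).
- by rewrite v1' in n1.
- by rewrite v2' in n2.
- by rewrite v1 in n1'.
- by case: disj.
- by rewrite v2 in n2'.
- by case: disj.
Qed.

Lemma hor_assemble k : (k < N)%N -> hor assemble k = H k.
Proof.
move=> kN; apply/setP=> d; rewrite inE; apply/idP/idP => [|dH]; last first.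
  by apply/assembleP; left; exists k, d.
case/assembleP=> [[j [e [jN eH E]]]|[j [x [jN _ /eqP]]]]; last first.
  by rewrite (negbTE (layer_neq_pillar _ _ _ jN)).
have [dom _ _] := is_tilingP _ _ _ _ (tilH jN).
have [x xe] := planar_domino_mem (dom e eH).1.
by have [<- <-] := layer_inj jN xe (esym E).
Qed.

Lemma ver_assemble k : (k <= N)%N -> ver assemble k = P k.
Proof.
move=> kN; apply/setP=> x; apply/idP/idP => [xv|xP].
  have r := ver_range assemble_tiling xv; move: xv; rewrite inE.
  case/assembleP=> [[j [e [jN eH /esym/eqP]]]|[j [y [jN yP E]]]].
    by rewrite (negbTE (layer_neq_pillar _ _ _ r)).
  by have [-> ->] := pillar_inj r E.
rewrite inE; apply/assembleP; right; exists k, x; split=> //.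
rewrite lt0n; apply/andP; split; first by apply/eqP=> k0; rewrite k0 P0 inE in xP.
by rewrite ltn_neqAle kN andbT; apply/eqP=> kE; rewrite kE PN inE in xP.
Qed.

End Assembly.

Lemma tiling_eq t t' : cube_tiling t -> cube_tiling t' ->
  (forall k, (k < N)%N -> hor t k = hor t' k /\ ver t k = ver t' k) -> t = t'.
Proof.
have sub s s' : cube_tiling s ->
    (forall k, (k < N)%N -> hor s k = hor s' k /\ ver s k = ver s' k) ->
    s \subset s'.
  move=> sT E; apply/subsetP=> B Bs.
  case: (cube_dominoP (tiling_domino sT Bs)) => [[i [d [_ BE]]]|[x [i [j [ji BE]]]]].
    have [/setP/(_ d)] := E i (ltn_ord i); rewrite !inE -BE Bs => <- //.
  have [_ /setP/(_ x)] := E j (ltn_ord j); rewrite !inE -BE Bs => <- //.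
move=> tT tT' E; apply/eqP; rewrite eqEsubset !sub // => k kN.
by have [-> ->] := E k kN.
Qed.

End CylinderTilings.

Section Balance.
Variable D : {fset int * int}.
Implicit Types (x y : D) (A B d : {set D}).

(** The number of white squares minus that of black ones: unlike equality of two cardinals, it is
    additive over disjoint unions. *)
Definition charge A : int := \sum_(x in A) (if white x then 1 else -1).

Lemma balanced_setE A : balanced_set A = (charge A == 0).
Proof.
rewrite /charge (bigID (@white D)) /=.
rewrite (eq_bigr (fun=> 1)) => [|x /andP[_ ->] //].
rewrite [X in _ + X](eq_bigr (fun=> -1)) => [|x /andP[_ /negbTE->] //].
rewrite !sumr_const mulNrn subr_eq0 !natz eqz_nat /balanced_set.
by congr (_ == _); apply: eq_card => x; rewrite !inE.
Qed.

Lemma chargeU A B : [disjoint A & B] -> charge (A :|: B) = charge A + charge B.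
Proof.
by move=> dAB; rewrite /charge -bigU //=; apply: eq_bigl => x; rewrite !inE.
Qed.

Lemma white_adjacent x y : sq_adjacent x y -> white y = ~~ white x.
Proof.
have add2 (a b a' b' : int) : (a, b) + (a', b') = (a + a', b + b') by [].
have even1 (n : int) : (2 %| n + 1)%Z = ~~ (2 %| n)%Z by lia.
rewrite /sq_adjacent /adjacent /white /sq_pos /=.
case: (fsval x) (fsval y) => [a b] [a' b'] /=; rewrite !add2 !xpair_eqE !orbF !addr0.
by case/orP=> /orP[]/andP[/eqP-> /eqP->];
  rewrite ?addrA ?(addrAC _ 1) even1 ?negbK.
Qed.

Lemma planar_tiling_balanced A (t : {set {set D}}) :
  planar_tiling A t -> charge A = 0.
Proof.
case/andP=> /andP[/eqP <- /andP[tI _]] /forall_inP dom.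
rewrite /charge big_trivIset //=; apply: big1 => d /dom /planar_dominoP[x [y [xy ->]]].
rewrite big_setU1 ?big_set1 /= ?(white_adjacent xy); last first.
  by rewrite inE; apply: contraTneq xy => ->; rewrite sq_adjacent_irr.
by case: white.
Qed.

End Balance.

(** * The bijection between tilings and closed walks *)

Section Floors.
Variable D : {fset int * int}.
Local Notation p0 := (empty_plug D).

(* The darts (f, true) and (f, false) of a loop are the same floor of a tiling, so
   only the first is kept; this makes tilings correspond bijectively to walks. *)
Definition pfloor : finType := (link D + loop D)%type.

Definition dart_of (e : pfloor) : dart (domino_graph D) :=
  match e with inl l => inl l | inr f => inr (f, true) end.

Definition psrc (e : pfloor) : plug D := floor_src (dart_of e).
Definition ptgt (e : pfloor) : plug D := floor_tgt (dart_of e).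
Definition ptiling (e : pfloor) : {set {set D}} := floor_tiling (dart_of e).
(** A loop is its own reverse here. Up to homotopy this agrees with the complex, where the disk
    along [f * f] makes a loop its own inverse. *)
Definition prev_floor (e : pfloor) : pfloor :=
  match e with inl l => inl (link_rev l) | inr f => inr f end.

Lemma psrc_rev e : psrc (prev_floor e) = ptgt e. Proof. by case: e. Qed.
Lemma ptgt_rev e : ptgt (prev_floor e) = psrc e. Proof. by case: e. Qed.

Lemma prev_floorK : involutive prev_floor.
Proof.
by case=> [l|f] //; have [E] := @floor_revK D (inl l); rewrite /= E.
Qed.

Lemma dart_of_spec e : floor_spec (psrc e) (ptgt e) (ptiling e) (dart_of e).
Proof. by rewrite /floor_spec !eqxx; case: e. Qed.

Lemma pfloor_valid e : [disjoint val (psrc e) & val (ptgt e)] /\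
  planar_tiling (~: (val (psrc e) :|: val (ptgt e))) (ptiling e).
Proof.
case: e => [l|f]; first by have /and3P[] := valP l.
split; first by rewrite -setI_eq0 /= set0I.
have -> : ~: (val (psrc (inr f)) :|: val (ptgt (inr f))) = [set: D].
  by rewrite /= setU0 setC0.
exact: valP f.
Qed.

(** A plug disjoint from itself is empty, so equal plugs give a loop at the empty plug and distinct
    ones a link. *)
Lemma pfloor_exists (p q : plug D) t : [disjoint val p & val q] ->
  planar_tiling (~: (val p :|: val q)) t ->
  exists e, [/\ psrc e = p, ptgt e = q & ptiling e = t].
Proof.
move=> dpq tt; have [epq|npq] := eqVneq p q; last first.
  have lP : [&& p != q, [disjoint val p & val q] &
    planar_tiling (~: (val p :|: val q)) t] by rewrite npq dpq.
  by exists (inl (exist _ (p, q, t) lP)).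
have p_0 : p = p0.
  apply: val_inj; apply/eqP; rewrite -[val p]setIid setI_eq0.
  by rewrite {2}epq.
have fP : planar_tiling [set: D] t.
  by move: tt; rewrite -epq p_0 /= setU0 setC0.
by exists (inr (exist _ t fP)); rewrite -epq p_0.
Qed.

Lemma pfloor_inj e e' :
  psrc e = psrc e' -> ptgt e = ptgt e' -> ptiling e = ptiling e' -> e = e'.
Proof.
have ne l f : psrc (inl l) = psrc (inr f) -> ptgt (inl l) = ptgt (inr f) -> False.
  by move=> /= es et; have /andP[/eqP] := valP l; rewrite [LHS]es [RHS]et.
case: e e' => [l|f] [l'|f'] es et eT.
- congr inl; apply: val_inj; move: es et eT; rewrite /psrc /ptgt /ptiling /=.
  by case: (val l) (val l') => [[? ?] ?] [[? ?] ?] /= -> -> ->.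
- by case: (ne l f').
- by case: (ne l' f).
- by congr inr; apply: val_inj.
Qed.

Local Notation pwalk := (ewalk psrc ptgt).

Definition walk_code (w : seq pfloor) := [seq (val (psrc e), ptiling e) | e <- w].

(** A code omits the targets: each is the source of the next edge, and the last one is the common
    end [z]. The induction therefore also has to return the equality of the starting points. *)
Lemma walk_code_inj x x' w w' z : pwalk x w z -> pwalk x' w' z ->
  walk_code w = walk_code w' -> x = x' /\ w = w'.
Proof.
elim: w w' x x' => [|e w IHw] [|e' w'] //= x x'; first by move=> /eqP-> /eqP->.
move=> /andP[/eqP<- ww] /andP[/eqP<- ww'] [es et E].
have [te ->] := IHw _ _ _ ww ww' E.
have es' : psrc e = psrc e' by apply: val_inj.
by rewrite (pfloor_inj es' te et).
Qed.

Section TilingCode.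
Variable N : nat.
Hypothesis balD : balanced D.
Local Notation cube_tiling :=
  (is_tiling dirs3 (@cube_pos D N) [set: cube D N]).
Implicit Types t : {set {set cube D N}}.

Definition tiling_code t := [seq (ver t k, hor t k) | k <- iota 0 N].

(** Upward induction: the disk and the planar tiling of floor [k] both have charge 0, so the charges
    of two consecutive plugs cancel. This is where the balance of the disk enters. *)
Lemma ver_balanced t k : cube_tiling t -> (k <= N)%N -> balanced_set (ver t k).
Proof.
move=> tT; rewrite balanced_setE; elim: k => [|k IHk] kN.
  by rewrite ver0 // /charge big_set0.
have := balD; rewrite /balanced balanced_setE -(setUCr (ver t k :|: ver t k.+1)).
rewrite chargeU -?setI_eq0 ?setICr // (planar_tiling_balanced (floor_planar_tiling tT kN)).
by rewrite chargeU ?disjoint_ver // (eqP (IHk (ltnW kN))) add0r addr0.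
Qed.

(** The walk is built downwards from the top, attaching one floor at a time in front of a walk that
    already ends at the empty plug. *)
Lemma tiling_walk t : cube_tiling t ->
  exists w, [/\ size w = N, pwalk p0 w p0 & walk_code w = tiling_code t].
Proof.
move=> tT; suff H m k : (k + m = N)%N -> exists w (x : plug D), [/\ size w = m,
    val x = ver t k, pwalk x w p0 & walk_code w = [seq (ver t j, hor t j) | j <- iota k m]].
  have [w [x [sw xE ww cw]]] := H N 0%N (add0n N).
  have x0 : x = p0 by apply: val_inj; rewrite xE ver0.
  by exists w; rewrite -{1}x0.
elim: m k => [|m IHm] k kmN.
  have -> : k = N by rewrite -kmN addn0.
  by exists [::], p0; rewrite /= eqxx verN.
rewrite addnS -addSn in kmN; have [w [y [sw yE ww cw]]] := IHm _ kmN.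
have kN : (k < N)%N by rewrite -kmN leq_addr.
pose x : plug D := exist _ (ver t k) (ver_balanced tT (ltnW kN)).
have [e [es et eT]] : exists e, [/\ psrc e = x, ptgt e = y & ptiling e = hor t k].
  apply: pfloor_exists; rewrite yE; first exact: disjoint_ver.
  exact: floor_planar_tiling.
by exists (e :: w), x; rewrite /= sw es et eqxx ww cw eT.
Qed.

Lemma tiling_code_nth t k : (k < N)%N ->
  nth (set0, set0) (tiling_code t) k = (ver t k, hor t k).
Proof. by move=> kN; rewrite (nth_map 0%N) ?size_iota // nth_iota. Qed.

Lemma tiling_code_inj t t' : cube_tiling t -> cube_tiling t' ->
  tiling_code t = tiling_code t' -> t = t'.
Proof.
move=> tT tT' E; apply: tiling_eq => // k kN.
by have := tiling_code_nth t kN; rewrite E tiling_code_nth // => -[-> ->].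
Qed.

Lemma walk_tiling w : size w = N -> pwalk p0 w p0 ->
  exists2 t, cube_tiling t & tiling_code t = walk_code w.
Proof.
move=> sw ww; pose c := walk_code w; have sc : size c = N by rewrite size_map.
(* Reading past the end of the code gives [set0], the correct plug at height [N]. *)
pose P k := (nth (set0, set0) c k).1; pose H k := (nth (set0, set0) c k).2.
have PN : P N = set0 by rewrite /P nth_default // sc.
have step k : (k < N)%N -> exists e,
    [/\ val (psrc e) = P k, val (ptgt e) = P k.+1 & ptiling e = H k].
  rewrite -sw /P /H /c; elim: w {1}(p0) ww k {sw c sc P H PN} => [//|e w IHw] x /=.
  move=> /andP[_ we] [_|k kw]; last exact: IHw _ we k kw.
  exists e; split=> //=; case: w we {IHw} => [/eqP-> //|e' w /andP[/eqP<-] //].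
have P0 : P 0%N = set0.
  rewrite /P /c; case: w ww {sw c sc P H PN step} => [//|e w /= /andP[/eqP-> _]] //.
have valid k : (k < N)%N -> [disjoint P k & P k.+1] /\
    planar_tiling (~: (P k :|: P k.+1)) (H k).
  by move=> /step[e [<- <- <-]]; apply: pfloor_valid.
have dP k (kN : (k < N)%N) := (valid k kN).1.
have tH k (kN : (k < N)%N) := (valid k kN).2.
exists (assemble N P H); first exact: assemble_tiling.
apply: (@eq_from_nth _ (set0, set0)) => [|k]; rewrite size_map size_iota ?sc //.
move=> kN; rewrite tiling_code_nth // ver_assemble // ?hor_assemble //; last exact: ltnW.
by rewrite /P /H; case: nth.
Qed.

(** Codes are injective on tilings and on walks, and have the same range; thus a uniform tiling
    corresponds to a uniform closed walk. *)
Lemma tilings_walks : exists W : cylinder_tiling D N -> seq pfloor,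
  (forall u, walk_code (W u) = tiling_code (val u)) /\
  perm_eq [seq W u | u <- enum {: cylinder_tiling D N}] (walks psrc ptgt N p0 p0).
Proof.
have /fin_all_exists[W WP] (u : cylinder_tiling D N) := tiling_walk (valP u).
exists W; split=> [u|]; first by have [] := WP u.
apply: uniq_perm; rewrite ?walks_uniq //.
  rewrite map_inj_uniq ?enum_uniq // => u u' E; apply: val_inj.
  apply: tiling_code_inj; rewrite ?(valP u) ?(valP u') //.
  by have [_ _ <-] := WP u; have [_ _ <-] := WP u'; rewrite E.
move=> w; rewrite mem_walks; apply/mapP/andP => [[u _ ->]|[/eqP sw ww]].
  by have [-> -> _] := WP u.
have [t tT tc] := walk_tiling sw ww; exists (exist _ t tT); first by rewrite mem_enum.
have [_ ww' cw'] := WP (exist _ t tT).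
by apply: (walk_code_inj ww ww' _).2; rewrite cw' tc.
Qed.

End TilingCode.
End Floors.

(** * Flips and homotopies *)

Section PathHomotopy.
Variables (K : two_complex) (x0 : vertex K).
Implicit Types (x y z : vertex K) (s t u : seq (dart K)).

(** Since [homotopic] only relates closed walks at [x0], homotopy with fixed ends [x] and [y] is
    tested inside every closed walk at [x0] through them. *)
Definition path_homotopic x y s t : Prop :=
  [/\ walk x s y, walk x t y & forall s1 s2, walk x0 s1 x -> walk y s2 x0 ->
    homotopic x0 (s1 ++ s ++ s2) (s1 ++ t ++ s2)].

Lemma path_homotopic_refl x y s : walk x s y -> path_homotopic x y s s.
Proof. by split=> // *; apply: rst_refl. Qed.

Lemma path_homotopic_sym x y s t :
  path_homotopic x y s t -> path_homotopic x y t s.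
Proof. by case=> ws wt H; split=> // *; apply/rst_sym/H. Qed.

Lemma path_homotopic_trans x y s t u :
  path_homotopic x y s t -> path_homotopic x y t u -> path_homotopic x y s u.
Proof.
case=> ws _ H [_ wu H']; split=> // s1 s2 w1 w2.
exact: rst_trans (H _ _ w1 w2) (H' _ _ w1 w2).
Qed.

Lemma path_homotopic_cat x y z s t s' t' :
  path_homotopic x y s t -> path_homotopic y z s' t' ->
  path_homotopic x z (s ++ s') (t ++ t').
Proof.
case=> ws wt H [ws' wt' H']; split; [exact: walk_cat ws ws'|exact: walk_cat wt wt'|].
move=> s1 s2 w1 w2; rewrite -!catA.
apply: rst_trans (H _ _ w1 (walk_cat ws' w2)) _.
by rewrite catA (catA s1 t); apply: H' => //; apply: walk_cat w1 wt.
Qed.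

(** Insert [walk_inv t ++ t] after [s], then delete the null walk [s ++ walk_inv t]. *)
Lemma path_homotopic_null x y s t : null_walk (s ++ walk_inv t) ->
  walk x s y -> walk x t y -> path_homotopic x y s t.
Proof.
move=> f ws wt; split=> // s1 s2 w1 w2.
have wV := walkV wt.
apply: (rst_trans _ _ _ (s1 ++ s ++ walk_inv t ++ t ++ s2)).
  by have := homotopic_cancel (walk_cat w1 ws) wV w2; rewrite walk_invK -!catA.
apply/rst_sym/rst_step; split.
- exact: walk_cat w1 (walk_cat wt w2).
- exact: walk_cat w1 (walk_cat ws (walk_cat wV (walk_cat wt w2))).
- by exists s1, (s ++ walk_inv t), (t ++ s2); rewrite -!catA.
Qed.

Lemma path_homotopic_cancel x d : dsrc d = x ->
  path_homotopic x x [:: d; drev d] [::].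
Proof.
move=> <-; apply: path_homotopic_null; rewrite /= ?dsrc_rev ?dtgt_rev ?eqxx //.
by right; exists d.
Qed.

End PathHomotopy.

Section FloorHomotopy.
Variable D : {fset int * int}.
Local Notation p0 := (empty_plug D).
Local Notation K := (domino_complex D).
Implicit Types (e : pfloor D) (x y : D) (d : {set D}).

Lemma walk_dart_of e : walk (psrc e : vertex K) [:: dart_of e] (ptgt e).
Proof. by rewrite /= !eqxx. Qed.

Lemma prev_homotopic e :
  @path_homotopic K p0 (ptgt e) (psrc e) [:: dart_of (prev_floor e)] [:: drev (dart_of e)].
Proof.
case: e => [l|f]; first by apply: path_homotopic_refl; rewrite /= !eqxx.
apply: path_homotopic_null; rewrite /= ?eqxx //; left.
exact: (@LoopFace D _ (inr (f, true)) (dart_of_spec (inr f))).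
Qed.

(** The quadrilateral 2-cell with [p1], [p2], [p3], [p4] equal to [psrc e1], [ptgt e1'], [ptgt e1],
    [ptgt e2]: half of its boundary is [e1' e2'], the other half is [e1 e2] backwards. *)
Lemma square_homotopic (e1 e2 e1' e2' : pfloor D) d :
  planar_domino d -> [disjoint d & val (ptgt e1)] ->
  psrc e1 = psrc e1' -> ptgt e2 = ptgt e2' ->
  ptgt e1 = psrc e2 -> ptgt e1' = psrc e2' ->
  val (ptgt e1') = val (ptgt e1) :|: d ->
  ptiling e1 = d |: ptiling e1' -> ptiling e2 = d |: ptiling e2' ->
  @path_homotopic K p0 (psrc e1) (ptgt e2)
    [:: dart_of e1; dart_of e2] [:: dart_of e1'; dart_of e2'].
Proof.
move=> pd dd es et em em' E t1 t2.
have rev1 := prev_homotopic (prev_floor e1); have rev2 := prev_homotopic (prev_floor e2).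
rewrite !psrc_rev !ptgt_rev !prev_floorK in rev1 rev2.
(* Faces traverse loops in the positive direction only, so each dart is first traded for the
   opposite of the dart of the reversed floor. *)
apply: (@path_homotopic_trans K p0 _ _ _
  [:: drev (dart_of (prev_floor e1)); drev (dart_of (prev_floor e2))]).
  by apply: (@path_homotopic_cat K p0 _ _ _ [:: _] [:: _] [:: _] [:: _] rev1); rewrite em.
apply: path_homotopic_sym; apply: path_homotopic_null.
- left; rewrite /walk_inv /= !floor_revK.
  apply: (@SquareFace D (psrc e1) (ptgt e1') (ptgt e1) (ptgt e2) d
    (ptiling e1') (ptiling e2')) => //.
  + by rewrite es disjoint_sym; have [] := pfloor_valid e1'.
  + by rewrite et em'; have [] := pfloor_valid e2'.
  + by rewrite es; apply: dart_of_spec.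
  + by rewrite et em'; apply: dart_of_spec.
  + rewrite -t2 em -psrc_rev -ptgt_rev.
    by have := dart_of_spec (prev_floor e2); rewrite /ptiling; case: (e2).
  + rewrite -t1 -psrc_rev -(ptgt_rev e1).
    by have := dart_of_spec (prev_floor e1); rewrite /ptiling; case: (e1).
- by rewrite es et /= -/(psrc _) -/(ptgt _) -/(psrc e2') em' !eqxx.
- have [_ w1 _] := rev1; have [_ w2 _] := rev2; rewrite -em in w2.
  exact: (@walk_cat K _ [:: _] _ [:: _] _ w1 w2).
Qed.

Lemma bigon_homotopic (e e' : pfloor D) : psrc e != ptgt e ->
  psrc e = psrc e' -> ptgt e = ptgt e' -> planar_flip (ptiling e) (ptiling e') ->
  @path_homotopic K p0 (psrc e) (ptgt e) [:: dart_of e] [:: dart_of e'].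
Proof.
move=> ne es et fl; apply: path_homotopic_null.
- left; apply: (@BigonFace D (psrc e) (ptgt e) (ptiling e) (ptiling e')) => //.
    exact: dart_of_spec.
  rewrite es et in ne *; case: e' ne {es et fl} => [l _|f]; last by rewrite eqxx.
  exact: dart_of_spec (inl (link_rev l)).
- exact: walk_dart_of.
- by rewrite es et; apply: walk_dart_of.
Qed.

Lemma planar_tilingD1 (t : {set {set D}}) d : planar_tiling [set: D] t -> d \in t ->
  planar_tiling (~: d) (t :\ d).
Proof.
move=> /is_tilingP[dom cov un] dt; apply/is_tilingP; split.
- move=> d'; rewrite !inE => /andP[ne dt']; split; first by have [] := dom _ dt'.
  apply/subsetP=> x xd'; rewrite inE; apply: contra ne => xd.
  by rewrite (un _ _ _ dt' dt xd' xd).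
- move=> x; rewrite inE => nx; have [d' dt' xd'] := cov x (in_setT x).
  exists d' => //; rewrite !inE dt' andbT.
  by apply: contraNneq nx => <-.
- by move=> d1 d2 x; rewrite !inE => /andP[_ d1t] /andP[_ d2t]; apply: un.
Qed.

Lemma domino_balanced d : planar_domino d -> balanced_set d.
Proof.
move=> pd; rewrite balanced_setE; apply/eqP.
apply: (@planar_tiling_balanced _ _ [set d]); apply/is_tilingP; split.
- by move=> d'; rewrite inE => /eqP->.
- by move=> x xd; exists d; rewrite ?inE.
- by move=> d1 d2 x; rewrite !inE => /eqP-> /eqP->.
Qed.

(* The flips of a tiling of the whole disk are not among the 2-cells: they are
   obtained by moving a domino not involved in the flip to the plug. *)
Lemma loop_homotopic (f f' : loop D) d :
  d \in val f -> d \in val f' -> planar_flip (val f :\ d) (val f' :\ d) ->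
  @path_homotopic K p0 p0 p0 [:: dart_of (inr f)] [:: dart_of (inr f')].
Proof.
move=> df df' fl; have fT := valP f; have fT' := valP f'.
have pd : planar_domino d by have [dom _ _] := is_tilingP _ _ _ _ fT; have [] := dom _ df.
pose p : plug D := exist _ d (domino_balanced pd).
have d0 : [disjoint val p0 & val p] by rewrite -setI_eq0 set0I.
have [e [es et eT]] : exists e, [/\ psrc e = p0, ptgt e = p & ptiling e = val f :\ d].
  by apply: pfloor_exists; rewrite // set0U; apply: planar_tilingD1.
have [e' [es' et' eT']] : exists e, [/\ psrc e = p0, ptgt e = p & ptiling e = val f' :\ d].
  by apply: pfloor_exists; rewrite // set0U; apply: planar_tilingD1.
have p_0 : p0 != p.
  apply/negP => /eqP/(congr1 val) /= E.
  by have [x] := planar_domino_mem pd; rewrite -E inE.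
have hom : @path_homotopic K p0 p0 p [:: dart_of e] [:: dart_of e'].
  by rewrite -{2}es -et; apply: bigon_homotopic; rewrite ?es ?et ?es' ?et' ?eT ?eT'.
have wr : walk (p : vertex K) [:: dart_of (prev_floor e')] p0.
  by rewrite -et' -es' -psrc_rev -(ptgt_rev e'); apply: walk_dart_of.
have wf' : walk (p0 : vertex K) [:: dart_of (inr f')] p0 by apply: (walk_dart_of (inr f')).
have back : @path_homotopic K p0 p0 p0
    ([:: dart_of e'] ++ [:: dart_of (prev_floor e')]) [::].
  apply: (@path_homotopic_trans K p0 _ _ _ ([:: dart_of e'] ++ [:: drev (dart_of e')])).
    rewrite -{2 3}es'; apply: path_homotopic_cat (prev_homotopic e').
    exact/path_homotopic_refl/walk_dart_of.
  by apply: path_homotopic_cancel; rewrite -es'.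
have f'E : @path_homotopic K p0 p0 p0 [:: dart_of (inr f')]
    ([:: dart_of e] ++ [:: dart_of (prev_floor e')] ++ [:: dart_of (inr f')]).
  apply: (@path_homotopic_trans K p0 _ _ _
    (([:: dart_of e'] ++ [:: dart_of (prev_floor e')]) ++ [:: dart_of (inr f')])).
    apply: (@path_homotopic_cat K p0 p0 p0 p0 [::] _ _ _ (path_homotopic_sym back)).
    exact: path_homotopic_refl.
  rewrite -catA; apply: path_homotopic_cat (path_homotopic_sym hom) _.
  exact: path_homotopic_refl (walk_cat wr wf').
apply: (@path_homotopic_trans K p0 p0 p0 _ [:: drev (dart_of (inr f))]).
  exact: prev_homotopic (inr f).
apply/path_homotopic_sym/(path_homotopic_trans f'E).
have we : walk (p0 : vertex K) [:: dart_of e] p by rewrite -et -{1}es; apply: walk_dart_of.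
apply: path_homotopic_null (walk_cat we (walk_cat wr wf')) _; last by rewrite /= !eqxx.
(* A degenerate quadrilateral in which [p1], [p3] and [p4] are all the empty plug: its sides are
   [e], the reverse of [e'], then [f'] and [f]. As [e] and [e'] are homotopic, [f'] is the inverse
   of [f], hence homotopic to [f]. *)
left; apply: (@SquareFace D p0 p p0 p0 d (val f :\ d) (val f' :\ d)) => //.
- by rewrite disjoint_sym.
- by rewrite disjoint_sym.
- by rewrite disjoint_sym.
- by rewrite /= set0U.
- by rewrite -es -et -eT; apply: dart_of_spec.
- rewrite -es' -et' -eT' -psrc_rev -(ptgt_rev e').
  by have := dart_of_spec (prev_floor e'); rewrite /ptiling; case: (e').
- by rewrite setD1K //; apply: (dart_of_spec (inr f')).
- by rewrite setD1K //; apply: (dart_of_spec (inr f)).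
Qed.

Lemma flip_square (a b c d x : D) (u v : int * int) :
  u \in dirs2 -> v \in dirs2 -> u != v -> val b = val a + u ->
  val c = val a + v -> val d = val a + u + v -> x \in [set a; b; c; d] ->
  (#|[set y in [set a; b; c; d] | sq_adjacent x y]| <= 2)%N.
Proof.
move=> uD vD uv eb ec ed xS.
have nad y z : val z = val y + u + v -> sq_adjacent y z = false /\ sq_adjacent z y = false.
  have add2 (p q p' q' : int) : (p, q) + (p', q') = (p + p', q + q') by [].
  rewrite /sq_adjacent /adjacent /sq_pos /= => ->; move: uD vD uv.
  case: (fsval y) => [p q]; rewrite !inE.
  by move=> /orP[]/eqP-> /orP[]/eqP-> //= _; rewrite !add2 !xpair_eqE; split; lia.
have nbc y z : val z + u = val y + v -> sq_adjacent y z = false.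
  have add2 (p q p' q' : int) : (p, q) + (p', q') = (p + p', q + q') by [].
  rewrite /sq_adjacent /adjacent /sq_pos /=; move: uD vD uv.
  case: (fsval y) (fsval z) => [p q] [p' q']; rewrite !inE.
  move=> /orP[]/eqP-> /orP[]/eqP-> //= _; rewrite !add2 !xpair_eqE => -[]; lia.
have sym y z : sq_adjacent y z = sq_adjacent z y.
  by rewrite /sq_adjacent /adjacent; apply: eq_has => w; rewrite orbC.
have [ad da] := nad a d ed.
have bc : sq_adjacent b c = false by apply: nbc; rewrite eb ec addrAC.
have cb : sq_adjacent c b = false by rewrite sym.
have sub2 (S : {set D}) y z : S \subset [set y; z] -> (#|S| <= 2)%N.
  by move=> /subset_leq_card/leq_trans-> //; rewrite cards2; case: eqP.
move: xS; rewrite !inE -!orbA => /or4P[]/eqP->;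
  [apply: (sub2 _ b c)|apply: (sub2 _ a d)|apply: (sub2 _ a d)|apply: (sub2 _ b c)];
  apply/subsetP=> y; rewrite !inE -!orbA => /andP[/or4P[]/eqP->];
  by rewrite ?sq_adjacent_irr ?ad ?da ?bc ?cb ?eqxx ?orbT.
Qed.

(** Were the two flipped dominoes the whole tiling, the disk would be a 2 x 2 square, where no cell
    has more than two neighbours. Nontriviality thus gives a third domino, left in place by the
    flip. *)
Lemma flip_other_domino (t t' : {set {set D}}) : nontrivial_disk D ->
  planar_tiling [set: D] t -> planar_tiling [set: D] t' -> planar_flip t t' ->
  exists d, [/\ d \in t, d \in t' & planar_flip (t :\ d) (t' :\ d)].
Proof.
move=> nt tT tT' /existsP[a /existsP[b /existsP[c /existsP[d]]]].
case/and4P=> /hasP[u uD /hasP[v vD /and4P[uv pb pc pd]]] abt cdt /eqP E.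
have [_ cov un] := is_tilingP _ _ _ _ tT.
have [d3 d3t /andP[n1 n2]] : exists2 d3, d3 \in t & (d3 != [set a; b]) && (d3 != [set c; d]).
  apply/exists_inP; apply: contraT; rewrite negb_exists_in => /forall_inP all2.
  move: nt; rewrite /nontrivial_disk negb_forall => /existsP[x].
  rewrite -ltnNge ltnNge => /negP[].
  have inS y : y \in [set a; b; c; d].
    have [B Bt yB] := cov y (in_setT y); move: (all2 _ Bt); rewrite negb_and !negbK.
    by case/orP=> /eqP EB; move: yB; rewrite EB !inE => /orP[]->; rewrite ?orbT.
  have := flip_square uD vD uv (eqP pb) (eqP pc) (eqP pd) (inS x).
  apply: leq_trans; apply: subset_leq_card; apply/subsetP=> y.
  by rewrite inE => xy; rewrite inE inS.
have nin x : x \in [set a; b; c; d] -> x \notin d3.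
  rewrite !inE -!orbA => xS; apply/negP => xd3.
  have [H|H] : x \in [set a; b] \/ x \in [set c; d].
  - by case/or4P: xS => /eqP->; rewrite !inE eqxx ?orbT; auto.
  - by move: n1; rewrite (un _ _ _ d3t abt xd3 H) eqxx.
  - by move: n2; rewrite (un _ _ _ d3t cdt xd3 H) eqxx.
have ne1 : d3 != [set a; c].
  by apply: contraNneq (nin a _) => [->|]; rewrite !inE eqxx.
have ne2 : d3 != [set b; d].
  by apply: contraNneq (nin b _) => [->|]; rewrite !inE eqxx ?orbT.
have d3t' : d3 \in t' by rewrite E !inE d3t n1 n2 !orbT.
exists d3; split=> //; apply/existsP; exists a; apply/existsP; exists b.
apply/existsP; exists c; apply/existsP; exists d; apply/and4P; split.
- by apply/hasP; exists u => //; apply/hasP; exists v => //; apply/and4P.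
- by rewrite !inE eq_sym n1.
- by rewrite !inE eq_sym n2.
apply/eqP/setP=> B; rewrite E !inE; case: (eqVneq B d3) => [->|_] /=.
  by rewrite (negbTE ne1) (negbTE ne2) !andbF.
by [].
Qed.

Lemma flip_homotopic (e e' : pfloor D) : nontrivial_disk D ->
  psrc e = psrc e' -> ptgt e = ptgt e' -> planar_flip (ptiling e) (ptiling e') ->
  @path_homotopic K p0 (psrc e) (ptgt e) [:: dart_of e] [:: dart_of e'].
Proof.
move=> nt es et fl; have [pq|] := eqVneq (psrc e) (ptgt e); last first.
  by move=> ?; apply: bigon_homotopic.
case: e e' es et fl pq => [l|f] e' es et fl pq.
  by have /and3P[/eqP] := valP l.
case: e' es et fl => [l|f'] es et fl.
  by have /and3P[/eqP[]] := valP l; rewrite -[LHS]es -[RHS]et.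
have [d [df df' fld]] := flip_other_domino nt (valP f) (valP f') fl.
exact: loop_homotopic df df' fld.
Qed.

End FloorHomotopy.

(** * Three-dimensional flips seen floor by floor *)

Section CylinderFlips.
Variables (D : {fset int * int}) (N : nat).
Implicit Types (x y : D) (d : {set D}) (k j : nat).
Implicit Types t : {set {set cube D N}}.
Local Notation cube_tiling :=
  (is_tiling dirs3 (@cube_pos D N) [set: cube D N]).

Lemma dirs3P (u : int * int * int) : u \in dirs3 ->
  (exists2 w, w \in dirs2 & u = (w, 0)) \/ u = (0, 1).
Proof.
rewrite !inE => /or3P[]/eqP->; [left|left|by right].
  by exists (1, 0).
by exists (0, 1).
Qed.

Lemma cube_posDh (p q : cube D N) w : cube_pos q = cube_pos p + (w, 0) ->
  val q.1 = val p.1 + w /\ q.2 = p.2.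
Proof.
move=> E; split; first exact: (congr1 fst E).
by apply: val_inj; have := congr1 snd E; rewrite /= addr0 => -[].
Qed.

Lemma cube_posDv (p q : cube D N) : cube_pos q = cube_pos p + (0, 1) ->
  q.1 = p.1 /\ q.2 = p.2.+1 :> nat.
Proof.
move=> E; split; first by apply: val_inj; rewrite [LHS](congr1 fst E) /= addr0.
by have := congr1 snd E => /=; lia.
Qed.

Lemma eq_layer k j d e x : (k < N)%N -> x \in d ->
  (layer N j e == layer N k d) = (j == k) && (e == d).
Proof.
move=> kN xd; apply/eqP/andP=> [E|[/eqP-> /eqP->] //].
by have [-> ->] := layer_inj kN xd (esym E); rewrite !eqxx.
Qed.

Lemma eq_pillar x y k j : (0 < k < N)%N ->
  (pillar N y j == pillar N x k) = (j == k) && (y == x).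
Proof.
move=> kN; apply/eqP/andP=> [E|[/eqP-> /eqP->] //].
by have [-> ->] := pillar_inj kN (esym E); rewrite !eqxx.
Qed.

Lemma eq_pillar_layer x k j d : (k < N)%N -> planar_domino d ->
  (pillar N x j == layer N k d) = false.
Proof.
move=> kN /planar_dominoP[y [z [yz ->]]]; apply/negP => /eqP/setP E.
have := E (y, Ordinal kN); have := E (z, Ordinal kN).
rewrite !inE /= !eqxx !orbT => /andP[/eqP zx _] /andP[/eqP yx _].
by move: yz; rewrite zx yx sq_adjacent_irr.
Qed.

(* The slab d x [k, k + 2] is tiled by two translates of d in t and by two
   vertical dominoes in t'. *)
Definition vertical_flip t t' k d : Prop :=
  [/\ (k.+1 < N)%N, planar_domino d,
      hor t k = d |: hor t' k /\ hor t k.+1 = d |: hor t' k.+1,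
      forall j, j != k -> j != k.+1 -> hor t j = hor t' j &
      ver t' k.+1 = ver t k.+1 :|: d /\ forall j, j != k.+1 -> ver t' j = ver t j].

Definition horizontal_flip t t' k : Prop :=
  [/\ (k < N)%N, planar_flip (hor t k) (hor t' k),
      forall j, j != k -> hor t j = hor t' j & forall j, ver t j = ver t' j].

(** The cases are the directions of [u], along the removed dominoes, and [v], along the new ones:
    both horizontal, or exactly one vertical. Both vertical contradicts [u != v]. *)
Lemma flip_cases t t' : flip dirs3 (@cube_pos D N) t t' ->
  [\/ exists k, horizontal_flip t t' k, exists k d, vertical_flip t t' k d
    | exists k d, vertical_flip t' t k d].
Proof.
have eqL (i : 'I_N) j d p q :
    (layer N j d == layer N i [set p; q]) = (j == i) && (d == [set p; q]).
  by apply: (@eq_layer _ _ _ _ p); rewrite ?inE ?eqxx.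
case/existsP=> -[x i] /existsP[[y j] /existsP[[z l] /existsP[[w m]]]].
case/and4P=> /hasP[u uD /hasP[v vD /and4P[uv /eqP pb /eqP pc /eqP pd]]] abt cdt /eqP E.
have [[u2 u2D ue]|ue] := dirs3P uD; have [[v2 v2D ve]|ve] := dirs3P vD; subst u v.
- have [/= yx ?] := cube_posDh pb; have [/= zx ?] := cube_posDh pc; subst j l.
  have [/= wx ?] : val w = val x + u2 + v2 /\ m = i.
    by rewrite -yx; apply: (@cube_posDh (y, i) (w, m) v2); rewrite pd pb.
  subst m; rewrite -!layer2 in abt cdt E; constructor 1; exists i.
  have adj (p q : D) r : r \in dirs2 -> val q = val p + r -> planar_domino [set p; q].
    move=> rD qp; apply/planar_dominoP; exists p, q; split=> //.
    by apply/hasP; exists r => //; rewrite /sq_pos qp eqxx.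
  split=> //.
  + apply/existsP; exists x; apply/existsP; exists y; apply/existsP; exists z.
    apply/existsP; exists w; apply/and4P; rewrite !inE abt cdt; split=> //.
      apply/hasP; exists u2 => //; apply/hasP; exists v2 => //.
      apply/and4P; rewrite /sq_pos /= yx zx wx !eqxx; split=> //.
      by apply: contraNneq uv => ->.
    apply/eqP/setP=> d; rewrite !inE E !inE.
    by rewrite !eqL !eqxx.
  + move=> j ji; apply/setP=> d; rewrite !inE E !inE.
    by rewrite !eqL (negbTE ji).
  + have ad1 := adj _ _ _ v2D zx; have ad2 := adj _ _ _ u2D yx.
    have ad3 : planar_domino [set y; w] by apply: (adj _ _ v2 v2D); rewrite /= wx yx.
    have ad4 : planar_domino [set z; w].
      by apply: (adj _ _ u2 u2D); rewrite /= wx zx addrAC.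
    by move=> j; apply/setP=> p; rewrite !inE E !inE !eq_pillar_layer.
- have [/= yx ?] := cube_posDh pb; have [/= ? li] := cube_posDv pc; subst j z.
  have [/= ? ml] : (w, m).1 = (y, i).1 /\ m = i.+1 :> nat.
    by apply: cube_posDv; rewrite pd pb.
  have ? : m = l by apply: val_inj; rewrite /= ml li.
  subst w m; rewrite -!layer2 -!(pillar2 _ li) in abt cdt E.
  have f : planar_domino [set x; y].
    apply/planar_dominoP; exists x, y; split=> //.
    by apply/hasP; exists u2 => //; rewrite /sq_pos /= yx eqxx.
  have lN : (0 < l < N)%N by rewrite ltn_ord li.
  constructor 2; exists i, [set x; y]; split=> //; first by rewrite -li.
  + by split; apply/setP=> d; rewrite -?li !inE E !inE !eqL !(negbTE (layer_neq_pillar _ _ _ lN)) /=;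
      case: (eqVneq d [set x; y]) => [->|_] //=; rewrite ?eqxx ?abt ?cdt ?andbF // !andbF.
  + move=> k ki kl; apply/setP=> d; rewrite !inE E !inE !eqL.
    by rewrite !(negbTE (layer_neq_pillar _ _ _ lN)) (negbTE ki) li (negbTE kl).
  + rewrite -li; split=> [|k kl]; apply/setP=> p;
      rewrite !inE E !inE !eq_pillar // !eq_pillar_layer // ?eqxx /=.
      by rewrite [RHS]orbC !orbA.
    by rewrite (negbTE kl).
- have [/= yx ji] := cube_posDv pb; have [/= zx ?] := cube_posDh pc; subst y l.
  have [/= ? mj] : (w, m).1 = (z, i).1 /\ m = i.+1 :> nat.
    by apply: cube_posDv; rewrite pd pc addrAC.
  have ? : m = j by apply: val_inj; rewrite /= mj ji.
  subst w m; rewrite -!layer2 -!(pillar2 _ ji) in abt cdt E.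
  have f : planar_domino [set x; z].
    apply/planar_dominoP; exists x, z; split=> //.
    by apply/hasP; exists v2 => //; rewrite /sq_pos /= zx eqxx.
  have jN : (0 < j < N)%N by rewrite ltn_ord ji.
  have ij : (i == j :> nat) = false by rewrite ji; lia.
  constructor 3; exists i, [set x; z]; split=> //; first by rewrite -ji.
  + split; apply/setP=> d; rewrite -?ji !inE E !inE !eqL !(negbTE (layer_neq_pillar _ _ _ jN)) /=.
      by rewrite eqxx ij.
    by rewrite eqxx eq_sym ij.
  + move=> k ki kj; apply/setP=> d; rewrite !inE E !inE !eqL.
    by rewrite !(negbTE (layer_neq_pillar _ _ _ jN)) (negbTE ki) ji (negbTE kj).
  + rewrite -ji; split=> [|k kj]; apply/setP=> p;
      rewrite !inE E !inE !eq_pillar // !eq_pillar_layer // ?eqxx /=.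
      case: (eqVneq p x) => [->|_]; first by rewrite abt ?orbT.
      by case: (eqVneq p z) => [->|_]; rewrite ?cdt ?orbT ?orbF.
    by rewrite (negbTE kj).
- by rewrite eqxx in uv.
Qed.

End CylinderFlips.

Lemma eq_outside (T : Type) (x0 : T) (s t : seq T) k m :
  size s = size t -> (k + m <= size s)%N ->
  (forall j, (j < k)%N || (k + m <= j)%N -> nth x0 s j = nth x0 t j) ->
  take k s = take k t /\ drop (k + m) s = drop (k + m) t.
Proof.
move=> st km E; have ks : (k <= size s)%N := leq_trans (leq_addr _ _) km.
split; apply: (@eq_from_nth _ x0) => [|j].
- by rewrite !size_takel -?st.
- by rewrite size_takel // => jk; rewrite !nth_take // E ?jk.
- by rewrite !size_drop st.
- by move=> _; rewrite !nth_drop E // leq_addr orbT.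
Qed.

Section CylinderHomotopy.
Variables (D : {fset int * int}) (N : nat).
Local Notation p0 := (empty_plug D).
Local Notation K := (domino_complex D).
Local Notation pwalk := (ewalk (@psrc D) (@ptgt D)).
Local Notation cube_tiling :=
  (is_tiling dirs3 (@cube_pos D N) [set: cube D N]).
Implicit Types (w : seq (pfloor D)) (t : {set {set cube D N}}).

Definition darts w : seq (dart K) := map (@dart_of D) w.

Lemma walk_darts x w y : @walk K x (darts w) y = pwalk x w y.
Proof. by elim: w x => [|e w IHw] x //=; rewrite IHw. Qed.

(** For the last edge the default [set0] of [nth] is the right value, because the walk ends at the
    empty plug. *)
Lemma nth_walk_tgt x w k e0 : pwalk x w p0 -> (k < size w)%N ->
  val (ptgt (nth e0 w k)) = (nth (set0, set0) (walk_code w) k.+1).1.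
Proof.
elim: w x k => [//|e w IHw] x [|k] /= /andP[_ we] kw; last exact: IHw we kw.
by case: w we {IHw kw} => [/eqP->|e' w /andP[/eqP<-]].
Qed.

Lemma nth_walk t w k e0 : cube_tiling t -> size w = N -> pwalk p0 w p0 ->
  walk_code w = tiling_code t -> (k < N)%N ->
  [/\ val (psrc (nth e0 w k)) = ver t k, val (ptgt (nth e0 w k)) = ver t k.+1
    & ptiling (nth e0 w k) = hor t k].
Proof.
move=> tT sw ww cw kN; have := tiling_code_nth t kN.
rewrite -cw (nth_map e0) ?sw // => -[E1 E2]; split=> //.
rewrite (nth_walk_tgt _ ww) ?sw // cw; have [kN'|Nk] := ltnP k.+1 N.
  by rewrite tiling_code_nth.
have -> : k.+1 = N by apply/eqP; rewrite eqn_leq kN.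
by rewrite nth_default ?verN // size_map size_iota.
Qed.

(** A nonempty [m] determines its own ends, so [x] and [y] are the vertices where [w1] stops and
    [w2] starts. *)
Lemma splice_homotopic w1 m m' w2 x y : (0 < size m)%N ->
  pwalk p0 (w1 ++ m ++ w2) p0 ->
  @path_homotopic K p0 x y (darts m) (darts m') ->
  @homotopic K p0 (darts (w1 ++ m ++ w2)) (darts (w1 ++ m' ++ w2)).
Proof.
move=> m0 /ewalk_split[x' ww1 /ewalk_split[y' wm ww2]] [wx _ H].
rewrite walk_darts in wx.
have xx' : x' = x.
  by case: m m0 wm wx {H} => [//|e m] _ /= /andP[/eqP<- _] /andP[/eqP<- _].
rewrite xx' in ww1 wm; rewrite -(ewalk_end wx wm) in ww2.
by rewrite /darts !map_cat; apply: H; rewrite walk_darts.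
Qed.

(** The two walks agree except on one floor (horizontal flip) or on two consecutive floors (vertical
    flip), and there [flip_homotopic] or [square_homotopic] applies. *)
Lemma cylinder_flip_homotopic t t' w w' : nontrivial_disk D ->
  cube_tiling t -> cube_tiling t' -> flip dirs3 (@cube_pos D N) t t' ->
  size w = N -> pwalk p0 w p0 -> walk_code w = tiling_code t ->
  size w' = N -> pwalk p0 w' p0 -> walk_code w' = tiling_code t' ->
  @homotopic K p0 (darts w) (darts w').
Proof.
move=> nt tT tT' /flip_cases fl sw ww cw sw' ww' cw'.
wlog {fl} fl : t t' tT tT' w w' sw ww cw sw' ww' cw' /
    (exists k, horizontal_flip t t' k) \/ exists k d, vertical_flip t t' k d.
  case: fl => [fl|fl|fl] H.
  - by apply: (H t t') => //; left.
  - by apply: (H t t') => //; right.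
  - by apply: rst_sym; apply: (H t' t) => //; right.
have N0 : (0 < N)%N.
  by case: fl => [[k [kN _ _ _]]|[k [d [kN _ _ _ _]]]]; apply: leq_trans kN.
have [e0 _] : exists e0 : pfloor D, True by case: w sw {ww cw} N0 => [<-|e *]; last exists e.
have nw k (kN : (k < N)%N) := nth_walk e0 tT sw ww cw kN.
have nw' k (kN : (k < N)%N) := nth_walk e0 tT' sw' ww' cw' kN.
have nth_eq j : ver t j = ver t' j -> ver t j.+1 = ver t' j.+1 -> hor t j = hor t' j ->
    nth e0 w j = nth e0 w' j.
  move=> v1 v2 h; have [jN|Nj] := ltnP j N; last by rewrite !nth_default ?sw ?sw'.
  have [a1 a2 a3] := nw j jN; have [b1 b2 b3] := nw' j jN.
  apply: pfloor_inj; last by rewrite a3 b3.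
    by apply: val_inj; rewrite [LHS]a1 [RHS]b1.
  by apply: val_inj; rewrite [LHS]a2 [RHS]b2.
have ssw : size w = size w' by rewrite sw sw'.
case: fl => [[k [kN fl hE vE]]|[k [d [kN pd [h1 h2] hE [v1 vE]]]]].
  have [E1 E2] : take k w = take k w' /\ drop (k + 1) w = drop (k + 1) w'.
    apply: (eq_outside (x0 := e0)) => //; first by rewrite addn1 sw.
    move=> j jk; apply: nth_eq; rewrite ?vE // hE //.
    by apply: contraTneq jk => ->; rewrite ltnn addn1 ltnn.
  have dec (v : seq (pfloor D)) : size v = N ->
      v = take k v ++ [:: nth e0 v k] ++ drop (k + 1) v.
    by move=> sv; rewrite -{1}(cat_take_drop k v) (drop_nth e0) ?sv // addn1.
  rewrite (dec w sw) (dec w' sw') -E1 -E2.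
  have [a1 a2 a3] := nw k kN; have [b1 b2 b3] := nw' k kN.
  apply: splice_homotopic => //; first by rewrite -(dec w sw).
  apply: flip_homotopic => //.
  - by apply: val_inj; rewrite [LHS]a1 [RHS]b1.
  - by apply: val_inj; rewrite [LHS]a2 [RHS]b2.
  - by rewrite a3 b3.
have kN' := ltnW kN.
have [E1 E2] : take k w = take k w' /\ drop (k + 2) w = drop (k + 2) w'.
  apply: (eq_outside (x0 := e0)) => //; first by rewrite addn2 sw.
  move=> j jk; have [n1 n2] : j != k /\ j != k.+1 by clear -jk; lia.
  by apply: nth_eq; [rewrite (vE _ n2)|rewrite vE|rewrite (hE _ n1 n2)].
have dec (v : seq (pfloor D)) : size v = N ->
    v = take k v ++ [:: nth e0 v k; nth e0 v k.+1] ++ drop (k + 2) v.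
  move=> sv; rewrite -{1}(cat_take_drop k v) (drop_nth e0) ?sv //.
  by rewrite (drop_nth e0) ?sv // addn2.
rewrite (dec w sw) (dec w' sw') -E1 -E2.
have [a1 a2 a3] := nw k kN'; have [b1 b2 b3] := nw' k kN'.
have [c1 c2 c3] := nw k.+1 kN; have [d1 d2 d3] := nw' k.+1 kN.
apply: splice_homotopic => //; first by rewrite -(dec w sw).
apply: (@square_homotopic D _ _ _ _ d) => //.
- rewrite [val _]a2 -setI_eq0; apply/eqP/setP=> x; rewrite in_setI in_set0.
  apply/negP => /andP[xd xv].
  have [dom _ _] := is_tilingP _ _ _ _ (floor_planar_tiling tT kN').
  have dt : d \in hor t k by rewrite h1 !inE eqxx.
  have [_ /subsetP/(_ x xd)] := dom d dt.
  by rewrite in_setC in_setU xv orbT.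
- by apply: val_inj; rewrite [LHS]a1 [RHS]b1 vE // ltn_eqF.
- by apply: val_inj; rewrite [LHS]c2 [RHS]d2 vE // gtn_eqF.
- by apply: val_inj; rewrite [LHS]a2 [RHS]c1.
- by apply: val_inj; rewrite [LHS]b2 [RHS]d1.
- by rewrite [LHS]b2 v1 [in RHS](_ : val _ = ver t k.+1).
- by rewrite a3 b3.
- by rewrite c3 d3.
Qed.

End CylinderHomotopy.

(** * Probability of flip equivalence *)

Section WalkImage.
Variables (D : {fset int * int}).
Variable phi : {multiplicative even_domino_group D -> F2}.
Local Notation p0 := (empty_plug D).
Local Notation K := (domino_complex D).
Local Notation pwalk := (ewalk (@psrc D) (@ptgt D)).
Implicit Types (s t : seq (dart K)) (c : closed_walk (p0 : vertex K)).

(** Made total on lists of darts: 1 is the default for a list that is not a closed walk at the empty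
    plug or has odd length. *)
Definition walk_image s : F2 :=
  if insub s : option {s : seq (dart K) | @walk K p0 s p0} is Some c then
    if insub (\pi_(domino_group D) c)%qT is Some g then phi g else 1%g
  else 1%g.

Lemma even_predE c : even_pred (\pi_(domino_group D) c)%qT = ~~ odd (size (val c)).
Proof. by rewrite /even_pred length_mod2E size_mod2. Qed.

Lemma walk_imageE c (ec : even_pred (\pi_(domino_group D) c)%qT) :
  walk_image (val c) = phi (Sub _ ec).
Proof.
rewrite /walk_image valK insubT.
by congr (phi _); apply: val_inj.
Qed.

Lemma walk_image_cat s t : @walk K p0 s p0 -> @walk K p0 t p0 ->
  ~~ odd (size s) -> ~~ odd (size t) ->
  walk_image (s ++ t) = (walk_image s * walk_image t)%g.
Proof.
move=> ws wt os ot.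
pose cs : closed_walk _ := exist _ s ws; pose ct : closed_walk _ := exist _ t wt.
have es : even_pred (\pi_(domino_group D) cs)%qT by rewrite even_predE.
have et : even_pred (\pi_(domino_group D) ct)%qT by rewrite even_predE.
have est : even_pred (\pi_(domino_group D) (closed_cat cs ct))%qT.
  by rewrite even_predE size_cat oddD (negbTE os) (negbTE ot).
rewrite (walk_imageE est) (walk_imageE es) (walk_imageE et) -gmulfM.
by congr (phi _); apply: val_inj; rewrite valM /= [RHS]pi1_mulE.
Qed.

Lemma walk_image_homotopic s t : @homotopic K p0 s t ->
  @walk K p0 s p0 -> @walk K p0 t p0 -> walk_image s = walk_image t.
Proof.
move=> st ws wt; pose cs : closed_walk _ := exist _ s ws.
pose ct : closed_walk _ := exist _ t wt; rewrite -[s]/(val cs) -[t]/(val ct).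
have E : (\pi_(domino_group D) cs = \pi_(domino_group D) ct)%qT.
  by apply/eqP; apply/(@homotopicP K p0).
by rewrite /walk_image !valK E.
Qed.

Definition unorient (a : dart K) : pfloor D :=
  match a with inl l => inl l | inr f => inr f.1 end.

(** A negatively oriented loop is homotopic to the positive one, so every homotopy class contains a
    walk made of floors. This transfers surjectivity from the group to walks of floors. *)
Lemma unorient_homotopic x s y : @walk K x s y ->
  @path_homotopic K p0 x y s (darts (map unorient s)).
Proof.
elim: s x => [|a s IHs] x /=; first by move/eqP->; apply: path_homotopic_refl; rewrite /= eqxx.
case/andP=> /eqP<- /IHs; apply: (@path_homotopic_cat K p0 _ _ _ [:: _] [:: _]).
case: a => [l|[f []]]; try by apply: path_homotopic_refl; rewrite /= !eqxx.
exact: path_homotopic_sym (prev_homotopic (inr f)).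
Qed.

Lemma walk_image_onto : (forall w, exists g, phi g = w) ->
  forall w, exists u, [/\ pwalk p0 u p0, ~~ odd (size u) & walk_image (darts u) = w].
Proof.
move=> onto w; have [g <-] := onto w; have [c cE] := pi1_piP (val g).
have [wc wu H] := unorient_homotopic (valP c).
exists (map unorient (val c)).
have eg : even_pred (\pi_(domino_group D) c)%qT by rewrite -cE; exact: valP g.
split; first by rewrite -walk_darts.
  by rewrite size_map -even_predE.
have {}H := H [::] [::] (eqxx _) (eqxx _); rewrite /= !cats0 in H.
rewrite -(walk_image_homotopic H) // (walk_imageE eg).
by congr (phi _); apply: val_inj; rewrite [LHS]/= -cE.
Qed.

End WalkImage.

From mathcomp Require Import reals topology normedtype landau sequences.

Section FlipProbability.
Variables (R : realType) (D : {fset int * int}).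
Local Notation p0 := (empty_plug D).
Local Notation K := (domino_complex D).
Local Notation pwalk := (ewalk (@psrc D) (@ptgt D)).

Lemma flip_equiv_homotopic N (W : cylinder_tiling D N -> seq (pfloor D)) :
  nontrivial_disk D -> balanced D ->
  (forall t, [/\ size (W t) = N, pwalk p0 (W t) p0
    & walk_code (W t) = tiling_code (val t)]) ->
  forall t t', flip_equiv t t' -> @homotopic K p0 (darts (W t)) (darts (W t')).
Proof.
move=> nt bal WP t t' /connectP[p pp ->]; elim: p t pp => [|u p IHp] t /=.
  by move=> _; apply: rst_refl.
case/andP=> tu /IHp; apply: rst_trans.
have [? ? ?] := WP t; have [? ? ?] := WP u.
exact: cylinder_flip_homotopic nt (valP t) (valP u) tu _ _ _ _ _ _.
Qed.

Lemma prob_flip_equiv_le : nontrivial_disk D -> balanced D -> strongly_irregular D ->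
  exists L (b : R), [/\ (0 < L)%N, 0 < b < 1 &
    forall N, prob_flip_equiv R D N <= b ^+ (N %/ L)].
Proof.
move=> nt bal [phi onto].
pose Phi s := walk_image phi (darts s).
have PhiM s t : pwalk p0 s p0 -> pwalk p0 t p0 -> ~~ odd (size s) ->
    ~~ odd (size t) -> Phi (s ++ t) = (Phi s * Phi t)%g.
  move=> ws wt os ot; rewrite /Phi /darts map_cat.
  by rewrite walk_image_cat ?size_map // walk_darts.
have Phi_rv e : psrc e = p0 -> Phi [:: e; prev_floor e] = 1%g.
  move=> se.
  have w0 : @walk K p0 [::] p0 by rewrite /= eqxx.
  have one : walk_image phi [::] = 1%g.
    by apply: (mulgI (walk_image phi [::])); rewrite -walk_image_cat ?mulg1.
  have H : @path_homotopic K p0 p0 p0 [:: dart_of e; dart_of (prev_floor e)] [::].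
    apply: (@path_homotopic_trans K p0 _ _ _ [:: dart_of e; drev (dart_of e)]).
      apply: (@path_homotopic_cat K p0 _ (ptgt e) _ [:: _] [:: _] [:: _] [:: _]).
        by rewrite -{2}se; apply/path_homotopic_refl/walk_dart_of.
      by rewrite -{2}se; apply: prev_homotopic.
    exact: path_homotopic_cancel.
  have [w1 _ {}H] := H; have := H [::] [::] w0 w0; rewrite /= => {}H.
  by rewrite -one; apply: walk_image_homotopic.
have [L [b [L0 b01 main]]] := walk_norm_contraction (@psrc_rev D) (@ptgt_rev D)
  PhiM Phi_rv (walk_image_onto onto) R.
exists L, b; split=> // N; have [b0 b1] := andP b01.
have [W [Wc Wp]] := tilings_walks N bal.
have WP t : [/\ size (W t) = N, pwalk p0 (W t) p0 & walk_code (W t) = tiling_code (val t)].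
  have : W t \in walks (@psrc D) (@ptgt D) N p0 p0.
    by rewrite -(perm_mem Wp) map_f // mem_enum.
  by rewrite mem_walks => /andP[/eqP].
set k := (N %/ L)%N; set T := #|{: cylinder_tiling D N}|.
have [t0|noT] := pickP {: cylinder_tiling D N}; last first.
  rewrite /prob_flip_equiv big_pred0 ?exprn_ge0 ?ltW // => -[t t'].
  by have := noT t.
move=> _; have [s0 ws0 _] := WP t0.
have T0 : (0 < T)%N by apply/card_gt0P; exists t0.
have Nk : N = (k * L + N %% L)%N := divn_eq N L.
(* [N] may be odd while images exist only in even length: the fixed closed walk [W t0], also of
   length [N], is put in front of all walks. *)
have := main k (N %% L)%N p0 (W t0) ws0.
rewrite -Nk s0 addnn odd_double => /(_ isT)[_].
rewrite -(sqnorm_perm _ (perm_map (fun w => Phi (W t0 ++ w)) Wp)) -(perm_size Wp).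
rewrite -map_comp sqnorm_collisions size_map -cardE -/T => coll.
rewrite /prob_flip_equiv /uniform_weight -/T.
have TR : 0 < T%:R :> R by rewrite ltr0n.
(* Flip-equivalent pairs give homotopic walks, so they are among the pairs with equal image counted
   by [coll]. *)
have le_coll : \sum_(u : cylinder_tiling D N * cylinder_tiling D N | flip_equiv u.1 u.2) 1
    <= (b ^+ k * T%:R) ^+ 2.
  apply: le_trans coll; rewrite big_mkcond pair_bigA; apply: ler_sum => -[t t'] _ /=.
  case: ifP => [tt'|_]; last exact: ler0n.
  suff -> : Phi (W t0 ++ W t) = Phi (W t0 ++ W t') by rewrite eqxx.
  have [_ wt _] := WP t; have [_ wt' _] := WP t'.
  apply: walk_image_homotopic; rewrite ?walk_darts; try exact: ewalk_cat ws0 _.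
  rewrite /darts !map_cat; apply: homotopic_catl; first by rewrite walk_darts.
  exact: flip_equiv_homotopic.
rewrite (eq_bigr (fun=> 1 * (T%:R^-1 / T%:R))) => [|u _]; last by rewrite mul1r.
rewrite -mulr_suml; have T2 : 0 <= T%:R^-1 / T%:R :> R.
  by rewrite divr_ge0 ?invr_ge0 ?ler0n.
apply: (le_trans (ler_wpM2r T2 le_coll)).
have -> : (b ^+ k * T%:R) ^+ 2 * (T%:R^-1 / T%:R) = b ^+ k * b ^+ k.
  by field; rewrite gt_eqF.
by rewrite ler_piMr ?exprn_ge0 ?exprn_ile1 // ltW.
Qed.

End FlipProbability.

(** Bernoulli's inequality, used to find [c < 1] with [b < c ^+ L] without an [L]-th root. *)
Lemma bernoulli_le (R : realFieldType) (x : R) n : 0 <= x <= 1 -> 1 - n%:R * x <= (1 - x) ^+ n.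
Proof.
case/andP=> x0 x1; elim: n => [|n IHn]; first by rewrite mul0r subr0 expr0.
have y0 : 0 <= 1 - x by rewrite subr_ge0.
have := ler_wpM2l y0 IHn; rewrite exprS; apply: le_trans.
have : 0 <= n%:R * x ^+ 2 by rewrite mulr_ge0 ?sqr_ge0.
rewrite -natr1; lra.
Qed.

Import numFieldNormedType.Exports.
Local Open Scope classical_set_scope.

Theorem theorem1 (R : realType) (D : {fset int * int}) :
  quadriculated_disk R D -> nontrivial_disk D -> balanced D ->
  strongly_irregular D ->
  exists2 c : R, 0 < c < 1 &
    (fun N : nat => prob_flip_equiv R D N : R^o) =o_\oo
    (fun N : nat => c ^+ N : R^o).
Proof.
move=> _ nt bal irr.
have [L [b [L0 /andP[b0 b1] main]]] := prob_flip_equiv_le R nt bal irr.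
(* Chosen so that Bernoulli's inequality gives [(1 - x) ^+ L >= (1 + b) / 2], which exceeds [b]. *)
pose x : R := (1 - b) / 2 / L%:R.
have LR : 1 <= L%:R :> R by rewrite ler1n.
have xL : x * L%:R = (1 - b) / 2 by rewrite /x divfK // gt_eqF // ltr0n.
have x0 : 0 < x by rewrite /x divr_gt0 ?ltr0n // divr_gt0 ?subr_gt0.
have x1 : x < 1.
  by rewrite /x ltr_pdivrMr ?ltr0n // mul1r; apply: lt_le_trans LR; lra.
exists (1 - x); first by rewrite subr_gt0 x1 ltrBlDr ltrDl.
set c := 1 - x; have c0 : 0 < c by rewrite subr_gt0.
have c1 : c <= 1 by rewrite /c lerBlDr lerDl ltW.
have cL : b < c ^+ L.
  apply: lt_le_trans (bernoulli_le L _); last by rewrite !ltW.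
  by rewrite mulrC xL; lra.
have cL0 : 0 < c ^+ L by rewrite exprn_gt0.
pose r := b / c ^+ L.
have r0 : 0 < r by rewrite divr_gt0.
have r1 : `|r| < 1 by rewrite gtr0_norm // ltr_pdivrMr // mul1r.
apply/eqoP => e e0.
(* The extra factor [c ^+ L] absorbs the remainder of [N] modulo [L], since
   [c ^+ (L * k) * c ^+ L <= c ^+ N]. *)
have ec0 : 0 < e * c ^+ L by rewrite mulr_gt0.
have /cvgr0Pnorm_le/(_ _ ec0)[K _ KP] := cvg_expr r1.
exists (K * L)%N => // N /= KN.
have P0 : 0 <= prob_flip_equiv R D N.
  by apply: sumr_ge0 => t _; rewrite mulr_ge0 // invr_ge0.
rewrite ger0_norm // ger0_norm ?exprn_ge0 ?(ltW c0) //; apply: le_trans (main N) _.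
have KN' : (K <= N %/ L)%N by rewrite leq_divRL.
have := KP _ KN'; rewrite ger0_norm ?exprn_ge0 ?(ltW r0) // => rK.
set k := (N %/ L)%N in rK *.
have -> : b ^+ k = r ^+ k * c ^+ (L * k).
  by rewrite exprM -exprMn /r divfK // gt_eqF.
have cN : c ^+ (L * k) * c ^+ L <= c ^+ N.
  rewrite -exprD [in leRHS](divn_eq N L) -/k (mulnC k).
  by apply: ler_wiXn2l; rewrite ?(ltW c0) // leq_add2l ltnW // ltn_mod.
apply: (@le_trans _ _ (e * c ^+ L * c ^+ (L * k))).
  by rewrite ler_wpM2r // exprn_ge0 // ltW.
by rewrite -mulrA ler_wpM2l ?(ltW e0) // mulrC.
Qed.
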